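(* Let $n,k\in\mathbb{N}=\{1,2,\dots\}$, let $A$ be a random $k\times n$ matrix whose entries are independent standard Gaussian random variables, regarded as a random linear operator $A:\mathbb{R}^n\to\mathbb{R}^k$. Let $M\subset\mathbb{R}^n$ be an arbitrary set such that its conic hull $\operatorname{pos} M$ is not a linear subspace. Then $$\gamma_k(\operatorname{pos} M)=\mathbb{P}[\operatorname{pos}(AM)=\mathbb{R}^k]=\mathbb{P}[0\in\operatorname{int}\operatorname{conv}(AM)].$$
   Context: All sets are tacitly assumed to be Borel. $AM=\{Ax:x\in M\}$. $\operatorname{conv}$ denotes the convex hull and $\operatorname{int}$ the topological interior. A non-empty set $C\subset\mathbb{R}^n$ is a convex cone if $\lambda_1x_1+\lambda_2x_2\in C$ for all $x_1,x_2\in C$ and $\lambda_1,\lambda_2\ge 0$ (in particular $0\in C$). For a set $M$, $\operatorname{pos} M$ is the smallest convex cone containing $M$, i.e. the set of all finite linear combinations of elements of $M$ with non-negative coefficients. For a convex cone $C\subset\mathbb{R}^n$ and $k\in\{0,\dots,n\}$, the $k$-th Grassmann angle is $\gamma_k(C):=\mathbb{P}[C\cap W_{n-k}\neq\{0\}]$, where $W_{n-k}$ is a random $(n-k)$-dimensional linear subspace of $\mathbb{R}^n$ uniformly distributed (Haar measure) on the Grassmannian of all such subspaces. By convention $\gamma_N(C):=0$ for all $N\ge\dim C$, in particular for $N>n$ (this is consistent with the definition), where $\dim C$ is the dimension of the linear hull of $C$. *)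

(* Defs.v *)
From HB Require Import structures.
From mathcomp Require Import all_boot all_order all_algebra.
From mathcomp Require Import all_classical all_reals all_analysis.

Set Implicit Arguments.
Unset Strict Implicit.
Unset Printing Implicit Defensive.

Import Order.TTheory GRing.Theory Num.Theory.
Import numFieldNormedType.Exports.

Local Open Scope classical_set_scope.
Local Open Scope ring_scope.

(** [R^n] is the space ['cV[R]_n] of column vectors, so that a matrix [A] acts
    by [A *m x]. *)

Definition borel (T : ptopologicalType) : measurableType _ :=
  g_sigma_algebraType (@open T).

(** ** Convexity *)

(** The empty combination ([m = 0]) is allowed, so [conic_hull set0 = [set 0]]. *)
Definition conic_hull (R : realType) (E : lmodType R) (M : set E) : set E :=
  [set x | exists (m : nat) (c : 'I_m -> R) (v : 'I_m -> E),
    [/\ forall i, 0 <= c i, forall i, M (v i) & x = \sum_(i < m) c i *: v i]].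

Definition convex_hull (R : realType) (E : lmodType R) (M : set E) : set E :=
  [set x | exists (m : nat) (c : 'I_m -> R) (v : 'I_m -> E),
    [/\ forall i, 0 <= c i, \sum_(i < m) c i = 1, forall i, M (v i)
      & x = \sum_(i < m) c i *: v i]].

Definition is_linear_subspace (R : realType) (n : nat) (C : set 'cV[R]_n) :=
  exists W : {vspace 'cV[R]_n}, C = [set x | x \in W].

(** ** Grassmann angles *)

(** A linear subspace [W] of [R^n] is represented by the matrix of the orthogonal
    projection onto [W].  This bijection identifies the Grassmannian of
    [m]-dimensional subspaces, with its usual topology, with a closed set of
    matrices. *)
Definition grassmannian (R : realType) (n m : nat) : set 'M[R]_n :=
  [set W | [/\ W^T = W, W *m W = W & \rank W = m]].

Definition subspace_of (R : realType) (n : nat) (W : 'M[R]_n) : set 'cV[R]_n :=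
  [set x | W *m x = x].

(** [W |-> Q *m W *m Q^T] is the action of the orthogonal group on subspaces: if
    [W] projects onto [L], then [Q *m W *m Q^T] projects onto [Q L]. *)
Definition is_haar_grassmannian (R : realType) (n m : nat)
    (mu : probability (borel 'M[R]_n) R) : Prop :=
  mu (@grassmannian R n m) = 1%E /\
  forall (Q : 'M[R]_n) (B : set (borel 'M[R]_n)), Q^T *m Q = 1%:M ->
    measurable B -> mu [set W : 'M[R]_n | B (Q *m W *m Q^T)] = mu B.

(** For [m <= n] there is exactly one such probability measure. *)
Definition haar_grassmannian (R : realType) (n m : nat) :
    probability (borel 'M[R]_n) R :=
  get [set mu | is_haar_grassmannian m mu].

(** For a Borel set [M] the event below with [C = conic_hull M] is analytic, hence
    universally measurable, but it need not be Borel.  The outer measure [mu^*]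
    evaluates the completion of [mu] on it, and agrees with [mu] on Borel sets.
    The angle is 0 by convention for [k > n]; for [dim C <= k <= n] it already
    vanishes, a uniform [(n - k)]-dimensional subspace almost surely meeting the
    linear hull of [C] only at the origin. *)
Definition grassmann_angle (R : realType) (n k : nat) (C : set 'cV[R]_n) :
    \bar R :=
  if (k <= n)%N then
    ((@haar_grassmannian R n (n - k))^*)%mu
      [set W | C `&` subspace_of W <> [set 0]]
  else 0%E.

(** ** Gaussian matrices *)

Definition mutually_independent d (T : measurableType d) (R : realType)
    (P : probability T R) (I : finType) (X : I -> {RV P >-> R}) : Prop :=
  forall (J : {set I}) (B : I -> set R), (forall i, measurable (B i)) ->
    P (\bigcap_(i in [set i | i \in J]) (X i @^-1` B i)) =
    (\prod_(i in J) P (X i @^-1` B i))%E.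

Definition random_matrix d (T : measurableType d) (R : realType)
    (P : probability T R) (k n : nat) (X : 'I_k -> 'I_n -> {RV P >-> R})
    (w : T) : 'M[R]_(k, n) :=
  \matrix_(i < k, j < n) X i j w.

Definition standard_gaussian_entries d (T : measurableType d) (R : realType)
    (P : probability T R) (k n : nat) (X : 'I_k -> 'I_n -> {RV P >-> R}) : Prop :=
  (forall i j (B : set R), measurable B ->
     distribution P (X i j) B = normal_prob 0 1 B) /\
  mutually_independent (fun ij : 'I_k * 'I_n => X ij.1 ij.2).

(* Main.v *)
(** Write [C = pos M].  If [A C = R^k] then [ker A] meets [C] outside [0]: pick [x] in [C]
    with [- x] not in [C] and [y] in [C] with [A y = - A x]; then [x + y] is in the kernel
    and nonzero.  Conversely, if [A C <> R^k] although [ker A] meets (the closure of) [C],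
    a separating [u] satisfies [u A c >= 0] on [C], and [A] touches [C].  Normalizing one
    coordinate of [u] and one of the kernel vector [x], say [u_i] and [x_j], each line in
    the direction [E_ij] contains at most one such [A], so touching has probability [0].

    It remains to see that the projection onto [ker A] is Haar distributed.  The law of [A]
    is right orthogonally invariant: orthogonal matrices are products of Givens rotations
    and sign changes, and a plane rotation is a product of three shears, which preserve
    Lebesgue measure.  Haar measure is unique because two probabilities giving equal mass
    to all balls of the same radius coincide (Christensen). *)

Require Import Defs.
From HB Require Import structures.
From mathcomp Require Import all_boot all_order all_algebra.
From mathcomp Require Import all_classical all_reals all_analysis.
From mathcomp Require Import measurable_realfun ring lra.

Set Implicit Arguments.
Unset Strict Implicit.
Unset Printing Implicit Defensive.

Import Order.TTheory GRing.Theory Num.Theory.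
Import numFieldNormedType.Exports.

Local Open Scope classical_set_scope.
Local Open Scope ring_scope.

(** * Borel sets of matrices *)

(** The event on the Grassmannian need not be Borel, so its outer measure is squeezed between two
    bounds. On the Gaussian side the event [A C = R^k] is open, hence Borel. Every Borel superset of
    the Grassmannian event pulls back to a superset of it, which bounds the angle from below. For
    the upper bound [C] is replaced by its closure: nonzero vectors are normalized into countably
    many compact cubes, projection along a compact factor preserves closedness, and so meeting the
    closure is a Borel event. The enlargement costs only a null set, since a functional that is
    nonnegative on [C] is nonnegative on the closure. [haar_grassmannian] is picked by choice, so
    both existence and uniqueness are required. The law of the kernel projection gives existence.
    For uniqueness, the orthogonal group acts transitively on the Grassmannian by isometries of the
    Frobenius distance, so a Haar probability gives equal mass to balls of equal radius centred
    there. *)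

Section BorelMatrix.
Context {R : realType} {m n : nat}.
Implicit Types A : 'M[R]_(m, n).

Definition rect (B : 'I_m -> 'I_n -> set R) : set 'M[R]_(m, n) :=
  [set A | forall i j, B i j (A i j)].

Lemma measurable_open (U : set 'M[R]_(m, n)) :
  open U -> measurable (U : set (borel 'M[R]_(m, n))).
Proof. exact: sub_sigma_algebra. Qed.

Lemma measurable_closed (U : set 'M[R]_(m, n)) :
  closed U -> measurable (U : set (borel 'M[R]_(m, n))).
Proof.
move=> cU; rewrite -[U]setCK; apply: measurableC.
by apply: measurable_open; exact: closed_openC.
Qed.

Lemma measurable_entry i j :
  measurable_fun [set: borel 'M[R]_(m, n)] (fun A : borel 'M[R]_(m, n) => A i j).
Proof.
apply: (measurability _ (RGenOpens.measurableE R)).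
move=> _ [_ [a [b ->] <-]]; rewrite setTI; apply: measurable_open.
apply: open_comp; last exact: interval_open.
by move=> A _; exact: coord_continuous.
Qed.

(** A countable base of the topology made of products of intervals: it links the Borel sets,
    generated by open sets, to conditions on single entries. *)
Definition rat_box (p : 'M[rat]_(m, n) * nat) :=
  rect (fun i j => ball (ratr (p.1 i j) : R) p.2.+1%:R^-1).

Lemma rat_box_cover (N : nat) A : exists q : 'M[rat]_(m, n), rat_box (q, N) A.
Proof.
have /choice[q qP] : forall ij : 'I_m * 'I_n,
    exists q : rat, ball (ratr q : R) N.+1%:R^-1 (A ij.1 ij.2).
  have N0 : 0 < N.+1%:R^-1 :> R by rewrite invr_gt0.
  move=> ij.
  have [|q] := @rat_in_itvoo R (A ij.1 ij.2) (A ij.1 ij.2 + N.+1%:R^-1).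
    by rewrite ltrDl.
  rewrite in_itv/= => /andP[q1 q2]; exists q; rewrite /ball/= ltr_norml.
  by move: N0 q2; move: (N.+1%:R^-1) => d d0 q2; apply/andP; split; lra.
by exists (\matrix_(i, j) q (i, j)) => i j /=; rewrite mxE; exact: (qP (i, j)).
Qed.

Lemma open_rat_boxes (U : set 'M[R]_(m, n)) : open U ->
  U = \bigcup_(p in [set p | rat_box p `<=` U]) rat_box p.
Proof.
move=> oU; apply/seteqP; split=> [A UA|A [[q N]]]; last exact.
have /nbhs_ballP[e /= e0 AeU] : nbhs A U by apply: open_nbhs_nbhs; split.
(* Two points of one box differ by less than twice its radius in each entry. *)
have [N Ne] : exists N : nat, N.+1%:R^-1 < e / 2.
  exists (Num.truncn (e / 2)^-1); rewrite invf_plt ?posrE ?divr_gt0//.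
  by rewrite truncnS_gt.
have [q qA] := rat_box_cover N A; exists (q, N) => //= B qB.
apply: AeU; split=> // i j; have := qB i j; have := qA i j.
rewrite /ball/= !ltr_norml; move: Ne; move: (N.+1%:R^-1) => d de.
by move=> /andP[h1 h2] /andP[h3 h4]; apply/andP; split; lra.
Qed.

Lemma measurable_rect_comp d (T : measurableType d) (f : T -> 'M[R]_(m, n)) B :
  (forall i j, measurable_fun setT (fun t => f t i j)) ->
  (forall i j, measurable (B i j)) -> measurable (f @^-1` rect B).
Proof.
move=> mf mB.
have -> : f @^-1` rect B =
    \bigcap_(ij in [set: 'I_m * 'I_n]) ((fun t => f t ij.1 ij.2) @^-1` B ij.1 ij.2).
  by apply/seteqP; split=> [t ft [i j] _|t ft i j]; [exact: ft|exact: (ft (i, j))].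
apply: fin_bigcap_measurable => [|[i j] _]; first exact: finite_finset.
by rewrite -[X in measurable X]setTI; exact: mf.
Qed.

Lemma measurable_rect (B : 'I_m -> 'I_n -> set R) :
  (forall i j, measurable (B i j)) -> measurable (rect B : set (borel 'M[R]_(m, n))).
Proof.
by apply: (@measurable_rect_comp _ (borel 'M[R]_(m, n)) id) => i j; exact: measurable_entry.
Qed.

Lemma measurable_mx d (T : measurableType d) (f : T -> 'M[R]_(m, n)) :
  (forall i j, measurable_fun setT (fun t => f t i j)) ->
  measurable_fun setT (f : T -> borel 'M[R]_(m, n)).
Proof.
move=> mf; apply: (@measurability _ _ T (borel 'M[R]_(m, n)) setT _ open) => // _ [U oU <-].
rewrite setTI (open_rat_boxes oU) preimage_bigcup.
rewrite bigcup_mkcond; apply: countable_bigcupT_measurable => // p.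
case: ifP => // _; apply: measurable_rect_comp => // i j; exact: measurable_ball.
Qed.

(** Rectangles with Borel sides are stable under intersection and, through the rational boxes,
    generate the Borel sets. *)
Lemma eq_measure_rect (P Q : probability (borel 'M[R]_(m, n)) R) :
  (forall B, (forall i j, measurable (B i j)) -> P (rect B) = Q (rect B)) ->
  forall S, measurable S -> P S = Q S.
Proof.
move=> PQ; pose G := [set rect B | B in [set B | forall i j, measurable (B i j)]].
apply: (@measure_unique _ R (borel 'M[R]_(m, n)) G (fun=> setT)) => //.
- apply/seteqP; split=> [S mS|]; last first.
    apply: smallest_sub; first exact: smallest_sigma_algebra.
    by move=> _ [B mB <-]; exact: measurable_rect.
  apply: (smallest_sub _ _ mS); first exact: smallest_sigma_algebra.
  move=> U oU; rewrite (open_rat_boxes oU) bigcup_mkcond.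
  apply: (@countable_bigcupT_measurable _ (g_sigma_algebraType G)) => // p.
  case: ifP => // _; apply: sub_sigma_algebra.
  by eexists; [|reflexivity] => i j; exact: measurable_ball.
- move=> _ _ [B mB <-] [C mC <-]; exists (fun i j => B i j `&` C i j).
    by move=> i j; exact: measurableI.
  apply/seteqP; split=> [A AB|A [AB AC] i j]; last by split.
  by split=> i j; have [] := AB i j.
- by move=> _; exists (fun _ _ => setT) => //; apply/seteqP; split.
- by rewrite bigcup_const.
- by move=> _ [B mB <-]; exact: PQ.
- by move=> _; rewrite [ltLHS](probability_setT P) ltry.
Qed.

End BorelMatrix.

(** * Continuity of matrix-valued functions *)

Section EntrywiseContinuity.
Context {R : realType} {T : topologicalType}.

Lemma continuous_sum (I : Type) (s : seq I) (P : pred I) (h : I -> T -> R) :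
  (forall i, continuous (h i)) -> continuous (fun t => \sum_(i <- s | P i) h i t).
Proof.
move=> ch; elim: s => [|i s IH].
  by under eq_fun do rewrite big_nil; exact: cst_continuous.
under eq_fun do rewrite big_cons; case: (P i) => // t.
by apply: (@continuousD R R^o T); [exact: ch|exact: IH].
Qed.

Lemma continuous_prod (I : Type) (s : seq I) (P : pred I) (h : I -> T -> R) :
  (forall i, continuous (h i)) -> continuous (fun t => \prod_(i <- s | P i) h i t).
Proof.
move=> ch; elim: s => [|i s IH].
  by under eq_fun do rewrite big_nil; exact: cst_continuous.
under eq_fun do rewrite big_cons; case: (P i) => // t.
by apply: continuousM; [exact: ch|exact: IH].
Qed.

(** Continuity is tracked by entries because those of products, determinants and adjugates are
    polynomials in the given entries. *)
Definition entrywise_continuous m n (f : T -> 'M[R]_(m, n)) :=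
  forall i j, continuous (fun t => f t i j).

Lemma entrywise_continuous_cst m n (A : 'M[R]_(m, n)) : entrywise_continuous (fun=> A).
Proof. by move=> i j; exact: cst_continuous. Qed.

Lemma entrywise_continuousM m n p (f : T -> 'M[R]_(m, n)) (g : T -> 'M[R]_(n, p)) :
  entrywise_continuous f -> entrywise_continuous g ->
  entrywise_continuous (fun t => f t *m g t).
Proof.
move=> cf cg i j; under eq_fun do rewrite mxE.
by apply: continuous_sum => l t; apply: continuousM; [exact: cf|exact: cg].
Qed.

Lemma entrywise_continuous_tr m n (f : T -> 'M[R]_(m, n)) :
  entrywise_continuous f -> entrywise_continuous (fun t => (f t)^T).
Proof. by move=> cf i j; under eq_fun do rewrite mxE; exact: cf. Qed.

Lemma continuous_det n (f : T -> 'M[R]_n) :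
  entrywise_continuous f -> continuous (fun t => \det (f t)).
Proof.
move=> cf; apply: continuous_sum => s.
have c1 : continuous (fun _ : T => (-1) ^+ perm.odd_perm s : R) by exact: cst_continuous.
have c2 : continuous (fun t => \prod_i f t i (perm.fun_of_perm s i)).
  by apply: continuous_prod => i; exact: cf.
by move=> t; exact: continuousM (c1 t) (c2 t).
Qed.

Lemma entrywise_continuous_adj n (f : T -> 'M[R]_n) :
  entrywise_continuous f -> entrywise_continuous (fun t => \adj (f t)).
Proof.
move=> cf i j; under eq_fun do rewrite mxE /cofactor.
have c1 : continuous (fun _ : T => (-1) ^+ (j + i) : R) by exact: cst_continuous.
have c2 : continuous (fun t => \det (row' j (col' i (f t)))).
  by apply: continuous_det => i' j'; under eq_fun do rewrite !mxE; exact: cf.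
by move=> t; exact: continuousM (c1 t) (c2 t).
Qed.

Lemma closed_ge0 (f : T -> R) : continuous f -> closed [set t | 0 <= f t].
Proof.
move=> cf; apply: (@closed_comp _ _ f [set x : R | 0 <= x]) => [t _|]; first exact: cf.
exact: closed_ge.
Qed.

Lemma closed_eq0 (f : T -> R) : continuous f -> closed [set t | f t = 0].
Proof.
move=> cf; apply: (@closed_comp _ _ f [set x : R | x = 0]) => [t _|]; first exact: cf.
exact: closed_eq.
Qed.

End EntrywiseContinuity.

Section MatrixContinuity.
Context {R : realType}.

Lemma entrywise_continuous_fst (T : topologicalType) m p :
  entrywise_continuous (fun z : 'M[R]_(m, p) * T => z.1).
Proof.
move=> i j z; apply: (@continuous_comp _ _ _ fst (fun A : 'M[R]_(m, p) => A i j)).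
  exact: cvg_fst.
exact: coord_continuous.
Qed.

Lemma entrywise_continuous_snd (T : topologicalType) m p :
  entrywise_continuous (fun z : T * 'M[R]_(m, p) => z.2).
Proof.
move=> i j z; apply: (@continuous_comp _ _ _ snd (fun A : 'M[R]_(m, p) => A i j)).
  exact: cvg_snd.
exact: coord_continuous.
Qed.

Lemma continuous_trmx m p : continuous (fun v : 'M[R]_(m, p) => v^T).
Proof.
move=> v S /nbhs_ballP[e e0 eS]; apply/nbhs_ballP; exists e => // w [_ vw].
by apply: eS; split=> // i j; rewrite !mxE.
Qed.

End MatrixContinuity.

(** The tube lemma: if no [u] in [K] is related to [t], compactness gives one neighbourhood of [t]
    that works for all [u]. It turns existence statements over compact cubes into closed conditions
    on the matrix. *)
Lemma closed_projection (T U : topologicalType) (K : set U) (F : set (T * U)) :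
  compact K -> closed F -> closed [set t | exists2 u, K u & F (t, u)].
Proof.
move=> /compact_near_coveringP cK cF; rewrite -openC openE => t nt.
have Hloc u : K u -> \forall u' \near u & t' \near t, ~ F (t', u').
  move=> Ku; have oF := closed_openC cF.
  have : nbhs (t, u) (~` F).
    apply: open_nbhs_nbhs; split; first exact: oF. by move=> Ftu; apply: nt; exists u.
  case=> -[V W] /= [Vt Wu] VW; exists (W, V) => //= -[x y] [/= Wx Vy].
  exact: (VW (y, x)).
have := cK T (nbhs t) (fun t u => ~ F (t, u)) (nbhs_filter t) Hloc.
apply: filterS => t' Kt' [u Ku Ftu]; exact: Kt' Ftu.
Qed.

Lemma compact_cube (R : realType) n (a b : 'I_n -> R) :
  compact [set v : 'rV[R]_n | forall i, v ord0 i \in `[a i, b i]].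
Proof.
apply: (@rV_compact _ _ (fun i => `[a i, b i]%classic)) => i.
exact: segment_compact.
Qed.

(** * Convex cones *)

Section ConicHull.
Context {R : realType} {E : lmodType R}.
Implicit Types (M : set E) (x y : E).

Definition convex_cone M :=
  [/\ M 0, forall x y, M x -> M y -> M (x + y) & forall (a : R) x, 0 <= a -> M x -> M (a *: x)].

Lemma convex_cone_sum M (I : Type) (s : seq I) (P : pred I) (f : I -> E) :
  convex_cone M -> (forall i, P i -> M (f i)) -> M (\sum_(i <- s | P i) f i).
Proof. by move=> [M0 MD _] Mf; elim/big_ind: _ => //; exact: MD. Qed.

Lemma conic_hull_cone M : convex_cone (conic_hull M).
Proof.
split.
- by exists 0%N, (fun=> 0), (fun=> 0); split => [|[]|]//; rewrite big_ord0.
- move=> _ _ [m [c [v [c0 Mv ->]]]] [p [d [w [d0 Mw ->]]]].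
  exists (m + p)%N,
    (fun i : 'I_(m + p) => match fintype.split i with inl j => c j | inr j => d j end),
    (fun i : 'I_(m + p) => match fintype.split i with inl j => v j | inr j => w j end).
  split=> [i|i|]; [by case: fintype.split|by case: fintype.split|].
  rewrite big_split_ord/=; congr (_ + _); apply: eq_bigr => i _.
    by rewrite -[lshift _ _]/(unsplit (inl i)) unsplitK.
  by rewrite -[rshift _ _]/(unsplit (inr i)) unsplitK.
- move=> a _ a0 [m [c [v [c0 Mv ->]]]].
  exists m, (fun i => a * c i), v; split=> // [i|]; first by rewrite mulr_ge0.
  by rewrite scaler_sumr; apply: eq_bigr => i _; rewrite scalerA.
Qed.

Lemma sub_conic_hull M : M `<=` conic_hull M.
Proof.
move=> x Mx; exists 1%N, (fun=> 1), (fun=> x).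
by split => //; rewrite big_ord1 scale1r.
Qed.

Lemma conic_hull_sub M (D : set E) : convex_cone D -> M `<=` D -> conic_hull M `<=` D.
Proof.
move=> cD MD _ [m [c [v [c0 Mv ->]]]]; apply: convex_cone_sum => // i _.
by case: cD => _ _; apply => //; exact: MD.
Qed.

End ConicHull.

Lemma conic_hull_image (R : realType) (E F : lmodType R) (f : {linear E -> F}) (M : set E) :
  conic_hull (f @` M) = f @` conic_hull M.
Proof.
apply/seteqP; split.
  have [C0 CD CZ] := conic_hull_cone M.
  apply: conic_hull_sub => [|_ [x Mx <-]]; last by exists x => //; exact: sub_conic_hull.
  split; first by exists 0; rewrite ?linear0.
    by move=> _ _ [x Cx <-] [y Cy <-]; exists (x + y); rewrite ?linearD//; exact: CD.
  by move=> a _ a0 [x Cx <-]; exists (a *: x); rewrite ?linearZ//; exact: CZ.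
move=> _ [_ [m [c [v [c0 Mv ->]]]] <-].
exists m, c, (f \o v); split=> // [i|]; first by exists (v i).
by rewrite linear_sum; apply: eq_bigr => i _; rewrite linearZ.
Qed.

Section Spanning.
Context {R : realType}.

Lemma conic_hull_mulmx k n (A : 'M[R]_(k, n)) (M : set 'cV[R]_n) :
  conic_hull [set A *m x | x in M] = [set A *m x | x in conic_hull M].
Proof. exact: (conic_hull_image (mulmx A)). Qed.

(* If [A B] is the identity and [A b = - (1, ..., 1)], then for [A'] near [A] the
   solution [p] of [A' B p = - det (A' B) A' b], polynomial in [A'] by Cramer's rule,
   still has positive entries: a strictly positive relation among spanning vectors. *)
Lemma open_mulmx_cone_setT k n (C : set 'cV[R]_n) : convex_cone C ->
  open [set A : 'M[R]_(k, n) | [set A *m x | x in C] = setT].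
Proof.
move=> cC; rewrite openE => A AC; have [C0 CD CZ] := cC.
have /choice[b bP] : forall j : 'I_k, exists b, C b /\ A *m b = delta_mx j ord0.
  move=> j; have : [set A *m x | x in C] (delta_mx j ord0) by rewrite AC.
  by case=> b Cb; exists b.
have : [set A *m x | x in C] (- const_mx 1) by rewrite AC.
case=> b' Cb' Ab'.
pose B := \matrix_(i, j) b j i ord0.
have AB : A *m B = 1%:M.
  apply/matrixP => i j; rewrite !mxE.
  have /matrixP/(_ i ord0) := (bP j).2; rewrite !mxE eqxx andbT => <-.
  by apply: eq_bigr => l _; rewrite mxE.
pose D (A' : 'M[R]_(k, n)) := \det (A' *m B).
pose p (A' : 'M[R]_(k, n)) := - (\adj (A' *m B) *m (A' *m b')).
have idc : entrywise_continuous (@id 'M[R]_(k, n)).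
  by move=> i j; exact: coord_continuous.
have cB : entrywise_continuous (fun A' : 'M[R]_(k, n) => A' *m B).
  by apply: entrywise_continuousM => //; exact: entrywise_continuous_cst.
have cD : continuous D by exact: continuous_det.
have cp i : continuous (fun A' => p A' i ord0).
  under eq_fun do rewrite mxE.
  move=> A'; apply: continuousN; apply: entrywise_continuousM.
    exact: entrywise_continuous_adj.
  by apply: entrywise_continuousM => //; exact: entrywise_continuous_cst.
have D0 : 0 < D A by rewrite /D AB det1.
have p0 i : 0 < p A i ord0.
  rewrite /p Ab' AB mulmxN opprK.
  have -> : \adj (1%:M : 'M[R]_k) = 1%:M by rewrite -[LHS]mul1mx mul_mx_adj det1.
  by rewrite mul1mx mxE.
have nD : \forall A' \near A, 0 < D A'.
  exact: (cvgr_gt _ (cD A)) D0.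
have np : \forall A' \near A, forall i, 0 < p A' i ord0.
  apply: (@filter_forall _ 'I_k (fun i A' => 0 < p A' i ord0) (nbhs A)) => i.
  exact: (cvgr_gt _ (cp i A)) (p0 i).
near=> A'.
have DA : 0 < D A' by near: A'.
have pA : forall i, 0 < p A' i ord0 by near: A'.
have rel : A' *m (B *m p A' + D A' *: b') = 0.
  rewrite mulmxDr mulmxA /p mulmxN mulmxA mul_mx_adj mul_scalar_mx.
  by rewrite -scalemxAr addNr.
have Bsum q : B *m q = \sum_j q j ord0 *: b j.
  apply/colP => i; rewrite !mxE summxE; apply: eq_bigr => j _.
  by rewrite !mxE mulrC.
have BC (q : 'cV_k) : (forall i, 0 <= q i ord0) -> C (B *m q).
  by move=> q0; rewrite Bsum; apply: convex_cone_sum => // j _; apply: CZ => //; exact: (bP j).1.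
apply/seteqP; split=> // z _.
pose q := invmx (A' *m B) *m z.
have zq : A' *m B *m q = z.
  by rewrite /q mulmxA mulmxV ?mul1mx// unitmxE unitfE gt_eqF.
(* Large enough that [q + t *: p A'] has nonnegative entries; by [rel], adding [t] times the
   relation leaves the image [z] unchanged. *)
pose t := \sum_j `|q j ord0| / p A' j ord0.
have t0 : 0 <= t by apply: sumr_ge0 => j _; rewrite divr_ge0// ltW.
exists (B *m (q + t *: p A') + (t * D A') *: b').
  apply: CD; last by apply: CZ => //; rewrite mulr_ge0// ltW.
  apply: BC => i; rewrite mxE [X in _ + X]mxE.
  suff : `|q i ord0| <= t * p A' i ord0.
    by have := ler_norm (- q i ord0); rewrite normrN; lra.
  rewrite -ler_pdivrMr// /t (bigD1 i)//= lerDl.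
  by apply: sumr_ge0 => j _; rewrite divr_ge0// ltW.
rewrite (mulmxDr B) -(scalemxAr t B) -scalerA -addrA -scalerDr mulmxDr mulmxA zq.
by rewrite -scalemxAr rel scaler0 addr0.
Unshelve. all: by end_near. Qed.

End Spanning.

Section Separation.
Context {R : realType}.

(** The unit vectors and the vector with all entries [-1] span the space positively. Density puts
    points of [D] close to these [k + 1] vectors, and positive spanning survives the perturbation
    because it is an open condition. *)
Lemma dense_cone_setT k (D : set 'cV[R]_k) : convex_cone D -> closure D = setT -> D = setT.
Proof.
move=> cD clD.
pose M : set 'cV[R]_(k + 1) := [set delta_mx i ord0 | i in [set: 'I_(k + 1)]].
pose A : 'M[R]_(k, k + 1) := row_mx 1%:M (const_mx (- 1)).
have coef (y : 'cV[R]_(k + 1)) : (forall i, 0 <= y i ord0) -> conic_hull M y.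
  move=> y0; have [C0 CD CZ] := conic_hull_cone M.
  rewrite (matrix_sum_delta y).
  apply: convex_cone_sum => [|i _]; first by split.
  rewrite big_ord1 ord1; apply: CZ => //; apply: sub_conic_hull; by exists i.
have spanA : [set A *m y | y in conic_hull M] = setT.
  apply/seteqP; split=> // z _.
  (* In [z = (z + t 1) - t 1], where [1] is the all-ones vector, all coefficients are nonnegative
     since [t] dominates every entry of [z]. *)
  pose t := \sum_i `|z i ord0|.
  have t0 : 0 <= t by apply: sumr_ge0.
  exists (col_mx (z + const_mx t) (const_mx t)).
    apply: coef => i; rewrite mxE; case: splitP => j _; rewrite !mxE//.
    rewrite /t (bigD1 j)//= addrA addr_ge0//; last exact: sumr_ge0.
    by have := ler_norm (- z j ord0); rewrite normrN; lra.
  rewrite mul_row_col mul1mx; apply/colP => i; rewrite !mxE big_ord1 !mxE.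
  by rewrite mulN1r addrK.
have oA := @open_mulmx_cone_setT R k (k + 1) _ (conic_hull_cone M).
have /nbhs_ballP[e /= e0 Ae] : nbhs A [set A | [set A *m y | y in conic_hull M] = setT].
  by apply: open_nbhs_nbhs; split.
have /choice[c cP] : forall j : 'I_(k + 1), exists c, D c /\ ball (col j A) e c.
  move=> j; have : closure D (col j A) by rewrite clD.
  move=> /(_ (ball (col j A) e))[|c [Dc bc]]; first exact: nbhsx_ballx.
  by exists c.
pose A' := \matrix_(i, j) c j i ord0.
have : [set A' *m y | y in conic_hull M] = setT.
  apply: Ae; split=> // i j; have [_ [_ /(_ i ord0)]] := cP j.
  by rewrite !mxE.
move=> spanA'; apply/seteqP; split => // z _.
have : [set A' *m y | y in conic_hull M] z by rewrite spanA'.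
rewrite -conic_hull_mulmx; apply: conic_hull_sub => // _ [_ [j _ <-] <-].
have -> : A' *m delta_mx j ord0 = c j; last exact: (cP j).1.
by rewrite -colE; apply/colP => i; rewrite !mxE.
Qed.

(* [u] is [p - z], where [p] is the point of [closure D] closest to [z]. *)
Lemma cone_separation k (D : set 'cV[R]_k) : convex_cone D -> D <> setT ->
  exists2 u : 'rV[R]_k, u != 0 & forall c, D c -> 0 <= (u *m c) ord0 ord0.
Proof.
move=> cD DT; have [D0 DD DZ] := cD.
have [z nz] : exists z, ~ closure D z.
  apply/not_existsP => h; apply: DT; apply: dense_cone_setT => //.
  by apply/seteqP; split=> // z _; have := h z; rewrite notK.
pose f (v : 'rV[R]_k) := \sum_i (v ord0 i - z i ord0) ^+ 2.
have cf : continuous f.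
  apply: continuous_sum => i v.
  have h : continuous (fun v : 'rV[R]_k => v ord0 i - z i ord0).
    move=> w; apply: (@continuousB R R^o _ (fun v : 'rV[R]_k => v ord0 i) (fun=> z i ord0)).
      exact: coord_continuous.
    exact: cst_continuous.
  exact: (continuousM (h v) (h v)).
pose cl := [set v : 'rV[R]_k | closure D v^T].
have clcl : closed cl.
  apply: (@preimage_closed _ _ (fun v : 'rV[R]_k => v^T)); last exact: closed_closure.
  by move=> v _; exact: continuous_trmx.
pose r := \sum_i z i ord0 ^+ 2 + 1.
have r0 : 0 <= \sum_i z i ord0 ^+ 2 by apply: sumr_ge0 => i _; exact: sqr_ge0.
(* The nearest point is sought in a compact cube around [z]; every [v] with [f v <= f 0] lies in
   that cube, as [|x| <= x^2 + 1]. *)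
pose K := cl `&` [set v : 'rV[R]_k | forall i, v ord0 i \in `[z i ord0 - r, z i ord0 + r]].
have rz x : x ^+ 2 <= \sum_i z i ord0 ^+ 2 -> `|x| <= r.
  move=> h; apply: le_trans (_ : x ^+ 2 + 1 <= _); last by rewrite /r lerD2r.
  by rewrite -real_normK ?num_real//; have := sqr_ge0 (`|x| - 1); rewrite !expr2; nra.
have cK : compact K by rewrite /K setIC; apply: compact_closedI => //; exact: compact_cube.
have K0 : K 0.
  split; first by rewrite /cl/= trmx0; exact: subset_closure.
  move=> i; rewrite mxE in_itv/=.
  have := rz (- z i ord0); rewrite sqrrN ler_norml (bigD1 i)//= lerDl.
  rewrite sumr_ge0 => [/(_ isT)|j _]; [lra|exact: sqr_ge0].
have [p Kp pmin] : exists2 p, p \in K & forall v, v \in K -> f p <= f v.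
  apply: compact_EVT_min => //; first by exists 0.
  exact: continuous_subspaceT.
rewrite inE in Kp; have clp : closure D p^T by case: Kp.
have f0 : f 0 = \sum_i z i ord0 ^+ 2.
  by apply: eq_bigr => i _; rewrite mxE sub0r sqrrN.
have minf v : cl v -> f p <= f v.
  move=> clv; have [fv|/ltW fv] := leP (f v) (f 0); last first.
    by apply: le_trans fv; apply: pmin; rewrite inE.
  apply: pmin; rewrite inE; split=> // i; rewrite in_itv/=.
  suff /rz : (v ord0 i - z i ord0) ^+ 2 <= \sum_i z i ord0 ^+ 2.
    by rewrite ler_norml; lra.
  apply: le_trans (_ : f v <= _); last by rewrite -f0.
  by rewrite /f (bigD1 i)//= lerDl; apply: sumr_ge0 => j _; exact: sqr_ge0.
exists (p - z^T).
  apply: contra_notN nz => /eqP/subr0_eq pz; move: clp; by rewrite pz trmxK.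
move=> c Dc; rewrite leNgt; apply/negP => s0.
pose s := ((p - z^T) *m c) ord0 ord0; pose q := \sum_i c i ord0 ^+ 2.
have q0 : 0 <= q by apply: sumr_ge0 => i _; exact: sqr_ge0.
have fpe e : f (p + e *: c^T) = f p + 2 * e * s + e ^+ 2 * q.
  rewrite /f /s /q mxE !mulr_sumr -!big_split/=; apply: eq_bigr => i _.
  by rewrite !mxE; ring.
have clpe e : 0 <= e -> cl (p + e *: c^T).
  move=> e0; rewrite /cl/= linearD/= linearZ/= trmxK.
  have clD : closed [set v : 'cV[R]_k | closure D (v + e *: c)].
    apply: (@preimage_closed _ _ (fun v : 'cV[R]_k => v + e *: c) (closure D)).
      move=> v _; apply: (@continuousD R 'cV[R]_k 'cV[R]_k (fun v => v)); first by move=> S.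
      exact: cst_continuous.
    exact: closed_closure.
  have : closure [set v : 'cV[R]_k | closure D (v + e *: c)] p^T.
    move: clp; apply: closure_subset => v Dv /=; apply: subset_closure.
    by apply: DD => //; exact: DZ.
  by rewrite -(closure_id _).1.
(* Nearly the minimizer [- s / q] of the quadratic in [fpe], with [q + 1] excluding a zero
   denominator. This step changes [f] by [e s - e^2], which is negative, although [p + e c] stays in
   the closure. *)
pose e := - s / (q + 1).
have e0 : 0 < e by rewrite divr_gt0 ?oppr_gt0//; lra.
have := minf _ (clpe _ (ltW e0)); rewrite fpe.
have es : e * (q + 1) = - s by rewrite /e divfK// gt_eqF//; lra.
have : e * (e * (q + 1)) = - e * s by rewrite es; ring.
have : 0 < e * - s by rewrite mulr_gt0// oppr_gt0.
have : 0 < e * e by rewrite mulr_gt0.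
rewrite expr2; nra.
Qed.

End Separation.

(** * Positive spanning and the interior of the convex hull *)

Section InteriorConvexHull.
Context {R : realType}.

(** Interpolates between the two hulls: some weight for the conic hull, weight 1 for the convex
    hull. Weights add and scale along with the points. *)
Definition weighted_hull (E : lmodType R) (M : set E) (x : E) (w : R) : Prop :=
  exists (m : nat) (c : 'I_m -> R) (v : 'I_m -> E),
    [/\ forall i, 0 <= c i, \sum_(i < m) c i = w, forall i, M (v i)
      & x = \sum_(i < m) c i *: v i].

Lemma weighted_hullD (E : lmodType R) (M : set E) x y (w a : R) :
  weighted_hull M x w -> weighted_hull M y a -> weighted_hull M (x + y) (w + a).
Proof.
move=> [m [c [v [c0 <- Mv ->]]]] [p [d [u [d0 <- Mu ->]]]].
exists (m + p)%N,
  (fun i : 'I_(m + p) => match fintype.split i with inl j => c j | inr j => d j end),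
  (fun i : 'I_(m + p) => match fintype.split i with inl j => v j | inr j => u j end).
split; [by move=> i; case: fintype.split|idtac|by move=> i; case: fintype.split|idtac].
all: rewrite big_split_ord/=; congr (_ + _); apply: eq_bigr => i _.
all: rewrite -?[lshift _ _]/(unsplit (inl i)) -?[rshift _ _]/(unsplit (inr i)) unsplitK//.
Qed.

Lemma weighted_hullZ (E : lmodType R) (M : set E) x (w a : R) : 0 <= a ->
  weighted_hull M x w -> weighted_hull M (a *: x) (a * w).
Proof.
move=> a0 [m [c [v [c0 <- Mv ->]]]].
exists m, (fun i => a * c i), v; split=> // [i||]; first by rewrite mulr_ge0.
  by rewrite mulr_sumr.
by rewrite scaler_sumr; apply: eq_bigr => i _; rewrite scalerA.
Qed.

Lemma weighted_hull0 (E : lmodType R) (M : set E) : weighted_hull M 0 0.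
Proof. by exists 0%N, (fun=> 0), (fun=> 0); split; rewrite ?big_ord0//; case. Qed.

Lemma weighted_hull_sum (E : lmodType R) (M : set E) (I : finType) (x : I -> E) (w : I -> R) :
  (forall i, weighted_hull M (x i) (w i)) -> weighted_hull M (\sum_i x i) (\sum_i w i).
Proof.
move=> h; elim/big_ind2 : _ => //; first exact: weighted_hull0.
by move=> *; exact: weighted_hullD.
Qed.

(** If [M] spans positively, points near 0 are conic combinations of total weight at most 1, and the
    missing weight can be put on 0, which itself has weight 1. Conversely, any point scales into a
    ball around 0. For [k = 0] and [M] empty the equivalence fails. *)
Lemma conic_hull_setT_interior k (M : set 'cV[R]_k) : (0 < k)%N ->
  conic_hull M = setT <-> (convex_hull M)° 0.
Proof.
move=> k0; split=> [MT|/nbhs_ballP[e /= e0 be]]; last first.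
  have MC : convex_hull M `<=` conic_hull M.
    by move=> _ [m [c [v [c0 _ Mv ->]]]]; exists m, c, v.
  apply/seteqP; split => // z _.
  have z0 : 0 < `|z| + 1 by rewrite ltr_wpDl.
  pose s := e / 2 / (`|z| + 1).
  have s0 : 0 < s by rewrite !divr_gt0.
  have -> : z = s^-1 *: (s *: z) by rewrite scalerA mulVf ?scale1r// gt_eqF.
  have [_ _ CZ] := conic_hull_cone M.
  apply: CZ; first by rewrite invr_ge0 ltW.
  apply/MC/be; rewrite -ball_normE/= sub0r normrN normrZ gtr0_norm//.
  apply: (@le_lt_trans _ _ (e / 2)); last by move: e0; lra.
  rewrite /s mulrAC -mulrA -[leRHS]mulr1 ler_pM2l ?divr_gt0//.
  by rewrite ler_pdivrMr// mul1r lerDl.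
have wh x : exists w, 0 <= w /\ weighted_hull M x w.
  have [m [c [v [c0 Mv xE]]]] : conic_hull M x by rewrite MT.
  exists (\sum_i c i); split; first exact: sumr_ge0.
  by exists m, c, v.
have wh0 x : weighted_hull M x 0 -> x = 0.
  move=> [m [c [v [c0 cs Mv ->]]]]; rewrite big1// => i _.
  have /eqP := cs; rewrite psumr_eq0// => /allP/(_ i); rewrite mem_index_enum => /(_ isT)/eqP ->.
  by rewrite scale0r.
(* A nonzero vector, available because [0 < k], has positive weight, so adding its negative
   represents 0 with positive weight; rescale this to 1. *)
have wh1 : weighted_hull M 0 1.
  pose x : 'cV[R]_k := const_mx 1.
  have [w [w0 xw]] := wh x; have [w' [w'0 xw']] := wh (- x).
  have W0 : 0 < w + w'.
    rewrite ltr_wpDr// lt_def w0 andbT; apply/eqP => w0'; move: xw; rewrite w0' => /wh0.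
    by move/matrixP/(_ (Ordinal k0) ord0); rewrite !mxE => /eqP; rewrite oner_eq0.
  have := weighted_hullD xw xw'; rewrite subrr => /(weighted_hullZ (a := (w + w')^-1)).
  by rewrite scaler0 mulVf ?gt_eqF//; apply; rewrite invr_ge0 ltW.
have /choice[w wP] : forall j : bool * 'I_k, exists w, 0 <= w /\
    weighted_hull M ((-1) ^+ j.1 *: delta_mx j.2 ord0) w by move=> j; exact: wh.
(* Bounds the weights of all vectors [delta_mx j ord0] and their negatives together, so entries
   below [1 / S] give total weight at most 1. *)
pose S := \sum_j (w (false, j) + w (true, j)) + 1.
have S0 : 0 < S.
  by rewrite /S ltr_wpDl// sumr_ge0// => j _; rewrite addr_ge0//; exact: (wP _).1.
apply/nbhs_ballP; exists S^-1 => /=; first by rewrite invr_gt0.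
move=> z [_ bz].
pose a j := `|z j ord0| * w (z j ord0 < 0, j).
have az : weighted_hull M z (\sum_j a j).
  have -> : z = \sum_j `|z j ord0| *: ((-1) ^+ (z j ord0 < 0)%R *: delta_mx j ord0).
    rewrite [LHS]matrix_sum_delta; apply: eq_bigr => j _; rewrite big_ord1 scalerA.
    by rewrite mulrC -realEsign ?num_real.
  by apply: weighted_hull_sum => j; apply: weighted_hullZ => //; exact: (wP (_, j)).2.
have a1 : \sum_j a j <= 1.
  have -> : 1 = S^-1 * S :> R by rewrite mulVf ?gt_eqF.
  rewrite /S mulrDr mulr_sumr -[leLHS]addr0 lerD//; last by rewrite mulr1 invr_ge0 ltW.
  apply: ler_sum => j _; apply: ler_pM => //; first exact: (wP _).1.
    by have := bz j ord0; rewrite mxE /ball/= sub0r normrN => /ltW.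
  by case: ltP => _; rewrite ?lerDl ?lerDr; exact: (wP _).1.
have := weighted_hullD az (weighted_hullZ (a := 1 - \sum_j a j) _ wh1).
by rewrite subr_ge0 scaler0 addr0 mulr1 addrC subrK; exact.
Qed.

End InteriorConvexHull.

(** * Orthogonal invariance of Gaussian matrices *)

Lemma ge0_integral_preserving d (T : measurableType d) (R : realType)
    (mu : {measure set T -> \bar R}) (f : T -> T) (D : set T) (g : T -> \bar R) :
  measurable_fun setT f -> (forall U, measurable U -> mu (f @^-1` U) = mu U) ->
  measurable D -> measurable_fun D g -> {in D, forall x, 0 <= g x}%E ->
  (\int[mu]_(x in f @^-1` D) g (f x) = \int[mu]_(x in D) g x)%E.
Proof.
move=> mf fmu mD mg g0; rewrite -(ge0_integral_pushforward mf mu mD mg g0).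
apply: (@eq_measure_integral _ _ _ D mu (pushforward mu f)) => // U mU _.
exact: fmu.
Qed.

(** * Rotation invariance of the planar Gaussian measure *)

Section PlaneRotation.
Context {R : realType}.
Notation leb := (@lebesgue_measure R).
Notation leb2 := (leb \x leb)%E.
Notation gam := (@normal_prob R 0 1).
Notation R2 := (measurableTypeR R * measurableTypeR R)%type.

Lemma lebesgue_measure_shift (t : R) (B : set R) : measurable B ->
  leb ((fun y => y + t) @^-1` B) = leb B.
Proof.
pose f (y : measurableTypeR R) : measurableTypeR R := y + t.
move=> mB; have mf : measurable_fun setT f by apply: measurable_funD.
apply/esym; apply: (lebesgue_measure_unique (mu := pushforward leb f)) => // _ [[a b] _ <-].
transitivity (leb `]a - t, b - t]%classic); last first.
  by congr (leb _); apply/seteqP; split=> y /=; rewrite !in_itv/= ltrBlDr lerBrDr.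
rewrite !lebesgue_measure_itv/= !lte_fin ltrD2r; case: ifP => // _.
by rewrite -!EFinB; congr EFin; ring.
Qed.

Lemma lebesgue2_shear2 (a : R) (S : set R2) : measurable S ->
  leb2 ((fun z : R2 => (z.1, z.2 + a * z.1)) @^-1` S) = leb2 S.
Proof.
move=> mS; rewrite /product_measure1; apply: eq_integral => x _ /=.
rewrite -[RHS](lebesgue_measure_shift (a * x)); last exact: measurable_xsection.
by congr (leb _); apply/seteqP; split=> y; rewrite /xsection/= !inE.
Qed.

Lemma measurable_shear1 (a : R) :
  measurable_fun setT (fun z : R2 => (z.1 + a * z.2, z.2)).
Proof.
apply/measurable_fun_pairP; split; last exact: measurable_snd.
apply: measurable_funD; first exact: measurable_fst.
by apply: measurable_funM => //; exact: measurable_snd.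
Qed.

Lemma measurable_shear2 (a : R) :
  measurable_fun setT (fun z : R2 => (z.1, z.2 + a * z.1)).
Proof.
apply/measurable_fun_pairP; split; first exact: measurable_fst.
apply: measurable_funD; first exact: measurable_snd.
by apply: measurable_funM => //; exact: measurable_fst.
Qed.

Lemma lebesgue2_shear1 (a : R) (S : set R2) : measurable S ->
  leb2 ((fun z : R2 => (z.1 + a * z.2, z.2)) @^-1` S) = leb2 S.
Proof.
move=> mS.
(* This shear translates horizontal sections, so the other order of integration is called for. *)
have E (U : set R2) : measurable U -> leb2 U = (leb \x^ leb)%E U.
  by move=> mU; apply: product_measure_unique => // *; exact: product_measure2E.
rewrite !E//; last first.
  by rewrite -[X in measurable X]setTI; exact: measurable_shear1.
apply: eq_integral => y _ /=.
rewrite -[RHS](lebesgue_measure_shift (a * y)); last exact: measurable_ysection.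
by congr (leb _); apply/seteqP; split=> x; rewrite /ysection/= !inE.
Qed.

Definition plane_rotation (c s : R) (z : R2) : R2 :=
  (c * (z.1 : R) - s * (z.2 : R), s * (z.1 : R) + c * (z.2 : R)).

Lemma measurable_plane_rotation c s : measurable_fun setT (plane_rotation c s).
Proof.
by apply/measurable_fun_pairP; split; [apply: measurable_funB|apply: measurable_funD];
  apply: measurable_funM => //; (exact: measurable_fst || exact: measurable_snd).
Qed.

(* A rotation with nonzero sine is a product of three shears. *)
Lemma lebesgue2_rotation (c s : R) (S : set R2) : c ^+ 2 + s ^+ 2 = 1 -> s != 0 ->
  measurable S -> leb2 (plane_rotation c s @^-1` S) = leb2 S.
Proof.
(* With [c] and [s] the cosine and sine of an angle, [a] is minus the tangent of half the angle. *)
move=> cs s0 mS; pose a := (c - 1) / s.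
have -> : plane_rotation c s @^-1` S = (fun z : R2 => (z.1 + a * z.2, z.2)) @^-1`
    ((fun z : R2 => (z.1, z.2 + s * z.1)) @^-1` ((fun z : R2 => (z.1 + a * z.2, z.2)) @^-1` S)).
  apply/funext => -[x y]; rewrite /preimage/=; congr (S _).
  rewrite /plane_rotation /= /a.
  have s2 : s ^+ 2 = 1 - c ^+ 2 by rewrite -cs; ring.
  congr pair; last by field.
  apply: (mulfI s0).
  have -> : s * (x + (c - 1) / s * y + (c - 1) / s * (y + s * (x + (c - 1) / s * y))) =
    s * x + (c - 1) * y + (c - 1) * (y + s * x + (c - 1) * y) by field.
  have h : s * s = 1 - c * c by rewrite -!expr2.
  by rewrite mulrBr !mulrA h; ring.
have m1 (U : set R2) : measurable U -> measurable ((fun z : R2 => (z.1 + a * z.2, z.2)) @^-1` U).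
  by move=> mU; rewrite -[X in measurable X]setTI; exact: measurable_shear1.
have m2 (U : set R2) : measurable U -> measurable ((fun z : R2 => (z.1, z.2 + s * z.1)) @^-1` U).
  by move=> mU; rewrite -[X in measurable X]setTI; exact: measurable_shear2.
rewrite (lebesgue2_shear1 a (m2 _ (m1 _ mS))) (lebesgue2_shear2 s (m1 _ mS)).
exact: lebesgue2_shear1.
Qed.

Definition gauss2_pdf (z : R2) : \bar R := (normal_pdf 0 1 z.1 * normal_pdf 0 1 z.2)%:E.

Lemma measurable_gauss2_pdf : measurable_fun setT gauss2_pdf.
Proof.
apply/measurable_EFinP; apply: measurable_funM.
  by apply: measurableT_comp => //; exact: measurable_normal_pdf.
by apply: measurableT_comp => //; exact: measurable_normal_pdf.
Qed.

Lemma gauss2_pdf_ge0 z : (0 <= gauss2_pdf z)%E.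
Proof. by rewrite lee_fin mulr_ge0// normal_pdf_ge0. Qed.

Lemma gauss2_pdf_rotation c s z : c ^+ 2 + s ^+ 2 = 1 ->
  gauss2_pdf (plane_rotation c s z) = gauss2_pdf z.
Proof.
move=> cs; rewrite /gauss2_pdf !normal_pdfE ?oner_eq0//= /normal_fun.
congr EFin; rewrite mulrACA [RHS]mulrACA; congr (_ * _).
rewrite -!expRD; congr expR; rewrite !subr0 -!mulrDl; congr (_ / _).
have -> : - (c * z.1 - s * z.2) ^+ 2 - (s * z.1 + c * z.2) ^+ 2 =
  - (c ^+ 2 + s ^+ 2) * (z.1 ^+ 2 + z.2 ^+ 2) by ring.
by rewrite cs; ring.
Qed.

(** The planar Gaussian measure through its Lebesgue density; as a registered measure it is
    identified with the product by [product_measure_unique]. *)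
Definition gauss2 (S : set R2) : \bar R := (\int[leb2]_(z in S) gauss2_pdf z)%E.

Let gauss2_0 : gauss2 set0 = 0%E.
Proof. exact: integral_set0. Qed.

Let gauss2_ge0 S : (0 <= gauss2 S)%E.
Proof. by apply: integral_ge0 => z _; exact: gauss2_pdf_ge0. Qed.

Let gauss2_sigma_additive : semi_sigma_additive gauss2.
Proof.
move=> F mF tF mUF; rewrite /gauss2 ge0_integral_bigcup//; last 2 first.
  exact: measurable_funTS measurable_gauss2_pdf.
  by move=> z _; exact: gauss2_pdf_ge0.
by apply: is_cvg_ereal_nneg_natsum_cond => i _ _; exact: gauss2_ge0.
Qed.

HB.instance Definition _ := isMeasure.Build _ _ _ gauss2
  gauss2_0 gauss2_ge0 gauss2_sigma_additive.

Lemma gauss2E (S : set R2) : measurable S -> (gam \x gam)%E S = gauss2 S.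
Proof.
apply: (@product_measure_unique _ _ _ _ R gam gam gauss2) => A B mA mB.
pose phi (D : set R) := (fun x => (normal_pdf 0 1 x)%:E) \_ D : R -> \bar R.
have phi0 D x : (0 <= phi D x)%E.
  by rewrite /phi patchE; case: ifP => // _; rewrite lee_fin normal_pdf_ge0.
have mphi D : measurable D -> measurable_fun setT (phi D).
  move=> mD; apply/(measurable_restrictT (fun x => (normal_pdf 0 1 x)%:E) mD).
  by apply: measurable_funTS; apply/measurable_EFinP; exact: measurable_normal_pdf.
have gphi D : (\int[leb]_x phi D x)%E = gam D.
  by rewrite /normal_prob [RHS]integral_mkcond.
have pE x y : (gauss2_pdf \_ (A `*` B)) (x, y) = (phi A x * phi B y)%E.
  rewrite /phi !patchE in_setX; case: (x \in A) => /=; last by rewrite mul0e.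
  by case: (y \in B) => /=; rewrite ?mule0.
transitivity (\int[leb2]_(z in A `*` B) gauss2_pdf z)%E => //.
rewrite integral_mkcond fubini_tonelli1/=; last 2 first.
- apply/(measurable_restrictT gauss2_pdf (measurableX mA mB)).
  exact: measurable_funTS measurable_gauss2_pdf.
- by move=> z; rewrite patchE; case: ifP => // _; exact: gauss2_pdf_ge0.
rewrite /fubini_F -!gphi.
under eq_integral => x _.
  under eq_integral do rewrite pE.
  rewrite ge0_integralZl//; [over|exact: mphi].
by rewrite ge0_integralZr//; [exact: mphi|exact: integral_ge0].
Qed.

Lemma gauss_rotation c s (S : set R2) : c ^+ 2 + s ^+ 2 = 1 -> s != 0 ->
  measurable S -> (gam \x gam)%E (plane_rotation c s @^-1` S) = (gam \x gam)%E S.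
Proof.
move=> cs s0 mS.
have mr : measurable (plane_rotation c s @^-1` S).
  by rewrite -[X in measurable X]setTI; exact: measurable_plane_rotation.
rewrite !gauss2E// /gauss2.
transitivity (\int[leb2]_(z in plane_rotation c s @^-1` S)
    gauss2_pdf (plane_rotation c s z))%E.
  by apply: eq_integral => z _; rewrite gauss2_pdf_rotation.
apply: ge0_integral_preserving => //.
- exact: measurable_plane_rotation.
- by move=> U mU; exact: lebesgue2_rotation.
- exact: measurable_funTS measurable_gauss2_pdf.
- by move=> z _; exact: gauss2_pdf_ge0.
Qed.

End PlaneRotation.

(** * Generation of the orthogonal group *)

Section Givens.
Context {R : realType} {n : nat}.
Implicit Types (p q : 'I_n) (c s : R).

(** The signs are chosen so that right multiplication applies [plane_rotation c s] to the entries in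
    columns [p] and [q] of each row. *)
Definition givens p q c s : 'M[R]_n :=
  \matrix_(i, j) if j == p then c *+ (i == p) - s *+ (i == q)
                 else if j == q then s *+ (i == p) + c *+ (i == q) else (i == j)%:R.

Definition flip p : 'M[R]_n := \matrix_(i, j) ((i == j)%:R * (-1) ^+ (j == p)).

Lemma sum_delta (F : 'I_n -> R) j : \sum_l F l * (l == j)%:R = F j.
Proof.
rewrite (bigD1 j)//= eqxx mulr1 big1 ?addr0// => l lj.
by rewrite (negbTE lj) mulr0.
Qed.

Lemma mulmx_givens m (A : 'M[R]_(m, n)) p q c s i j :
  (A *m givens p q c s) i j =
    if j == p then c * A i p - s * A i q
    else if j == q then s * A i p + c * A i q else A i j.
Proof.
rewrite mxE; under eq_bigr do rewrite mxE.
have [_|_] := eqVneq j p.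
  rewrite -(sum_delta (fun l => A i l) p) -(sum_delta (fun l => A i l) q).
  rewrite !mulr_sumr -sumrB; apply: eq_bigr => l _.
  by case: (l == p); case: (l == q); rewrite ?mulr1n ?mulr0n; ring.
have [_|_] := eqVneq j q; last exact: sum_delta.
rewrite -(sum_delta (fun l => A i l) p) -(sum_delta (fun l => A i l) q).
rewrite !mulr_sumr -big_split/=; apply: eq_bigr => l _.
by case: (l == p); case: (l == q); rewrite ?mulr1n ?mulr0n; ring.
Qed.

Lemma mulmx_flip m (A : 'M[R]_(m, n)) p i j :
  (A *m flip p) i j = A i j * (-1) ^+ (j == p).
Proof.
rewrite mxE; under eq_bigr do rewrite mxE mulrA.
by rewrite -mulr_suml sum_delta.
Qed.

Lemma flipK p : flip p *m flip p = 1%:M.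
Proof.
apply/matrixP => i j; rewrite mulmx_flip !mxE -mulrA -expr2 sqrr_sign mulr1.
by [].
Qed.

Lemma givensK p q c s : p != q -> c ^+ 2 + s ^+ 2 = 1 ->
  givens p q c s *m givens p q c (- s) = 1%:M.
Proof.
move=> pq cs; apply/matrixP => i j.
rewrite mulmx_givens !mxE !eqxx eq_sym [q == p]eq_sym (negbTE pq).
have [->|jp] := eqVneq j p.
  transitivity ((c ^+ 2 + s ^+ 2) * (i == p)%:R); [|by rewrite cs mul1r].
  by case: (i == p); case: (i == q); rewrite ?mulr1n ?mulr0n; ring.
have [->|jq] := eqVneq j q; last by [].
transitivity ((c ^+ 2 + s ^+ 2) * (i == q)%:R); [|by rewrite cs mul1r].
  by case: (i == p); case: (i == q); rewrite ?mulr1n ?mulr0n; ring.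
Qed.

Lemma tr_givens p q c s : p != q -> (givens p q c s)^T = givens p q c (- s).
Proof.
move=> pq; apply/matrixP => i j; rewrite !mxE.
have qp : (q == p) = false by rewrite eq_sym (negbTE pq).
have [->|ip] := eqVneq i p; have [->|jp] := eqVneq j p;
  rewrite ?eqxx ?(negbTE pq) ?qp ?(negbTE ip) ?(negbTE jp) ?mulr0n ?mulr1n
    ?subr0 ?sub0r ?addr0 ?add0r ?oppr0//.
- by have [_|_] := eqVneq j q; rewrite ?mulr1n ?mulr0n ?oppr0.
- by have [_|_] := eqVneq i q; rewrite ?mulr1n ?mulr0n ?opprK ?oppr0// eq_sym (negbTE ip).
have [iE|iq] := eqVneq i q; have [jE|jq] := eqVneq j q; rewrite ?mulr1n ?mulr0n//.
- by rewrite iE eq_sym (negbTE jq).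
- by rewrite jE eq_sym (negbTE iq).
- by rewrite eq_sym.
Qed.

Lemma tr_flip p : (flip p)^T = flip p.
Proof.
apply/matrixP => i j; rewrite !mxE eq_sym; have [->//|] := eqVneq i j.
by rewrite !mul0r.
Qed.

End Givens.

Section OrthogonalInduction.
Context {R : realType} {n : nat} (P : 'M[R]_n -> Prop).
Hypothesis P1 : P 1%:M.
Hypothesis PM : forall A B, P A -> P B -> P (A *m B).
Hypothesis Pgivens : forall p q c s, p != q -> s != 0 -> c ^+ 2 + s ^+ 2 = 1 -> P (givens p q c s).
Hypothesis Pflip : forall p, P (flip p).

Let Prem Q G H : G *m H = 1%:M -> P H -> P (Q *m G) -> P Q.
Proof.
by move=> GH PH PQ; rewrite -[Q]mulmx1 -GH mulmxA; exact: PM.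
Qed.

Let id_rows (m : nat) (Q : 'M[R]_n) := forall i j : 'I_n, (i < m)%N -> Q i j = (i == j)%:R.

(** Elimination from the right: once the first [m] rows are those of the identity, rotations clear
    row [m] to the right of the diagonal, a sign change makes its diagonal entry 1, and the
    induction goes on with [m + 1]. *)
Lemma orthogonal_ind Q : Q^T *m Q = 1%:M -> P Q.
Proof.
suff H k m : (n - m <= k)%N -> forall Q, Q *m Q^T = 1%:M -> id_rows m Q -> P Q.
  by move=> /mulmx1C QQ; apply: (H n 0%N); rewrite ?leq_subr.
elim: k m => [|k IHk] m.
  rewrite leqn0 subn_eq0 => nm {}Q _ Qid.
  rewrite (_ : Q = 1%:M)//; apply/matrixP => i j; rewrite mxE Qid//.
  exact: leq_trans nm.
move=> nmk; have [nm|mn] := leqP n m.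
  by apply: IHk; rewrite (eqP (_ : n - m == 0)%N) ?subn_eq0.
pose im := Ordinal mn.
(* Inner induction on the number of nonzero entries of row [m] to the right of the diagonal. *)
suff H l (Q' : 'M[R]_n) : (#|[set j : 'I_n | (m < j)%N & (Q' im j != 0)%R]| <= l)%N ->
    Q' *m Q'^T = 1%:M -> id_rows m Q' -> P Q'.
  by move=> Q'; exact: H (leqnn _).
elim: l Q' => [|l IHl] Q'.
  rewrite leqn0 cards_eq0 => /eqP/setP row0 QQ Qid.
  have Qm0 j : j != im -> Q' im j = 0.
    move=> jim; have [mj|jm|mj] := ltngtP m j.
    - by have := row0 j; rewrite !inE mj/= => /negbFE/eqP.
    (* Left of the diagonal: row [m] is orthogonal to row [j], which is a unit coordinate vector. *)
    - have := QQ => /matrixP/(_ j im); rewrite !mxE (negbTE jim) mulr0n => <-.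
      rewrite (bigD1 j)//= mxE (Qid j j jm) eqxx mul1r big1 ?addr0// => l lj.
      by rewrite (Qid j l jm) eq_sym (negbTE lj) mul0r.
    - by move: jim; rewrite -val_eqE/= -mj eqxx.
  have Qmm : Q' im im ^+ 2 = 1.
    have := QQ => /matrixP/(_ im im); rewrite !mxE eqxx mulr1n => <-.
    rewrite (bigD1 im)//= mxE big1 ?addr0// => l lj.
    by rewrite Qm0// mul0r.
  have fin Q2 : Q2 *m Q2^T = 1%:M -> id_rows m Q2 -> (forall j, Q2 im j = (im == j)%:R) -> P Q2.
    move=> Q2o Q2id Q2m; apply: (IHk m.+1) => //; first by rewrite subnS -ltnS prednK ?subn_gt0.
    move=> i j; rewrite ltnS leq_eqVlt => /orP[/eqP im'|]; last exact: Q2id.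
    by have -> : i = im by [exact: val_inj]; exact: Q2m.
  have /orP[/eqP Q1|/eqP QN1] : (Q' im im == 1) || (Q' im im == -1) by rewrite -sqrf_eq1 Qmm.
    apply: fin => // j; have [<-//|jm] := eqVneq im j.
    by rewrite Qm0// eq_sym.
  apply: (Prem (flipK im)); first exact: Pflip.
  apply: fin.
  - by rewrite trmx_mul mulmxA -(mulmxA Q') tr_flip flipK mulmx1.
  - move=> i j im'; rewrite mulmx_flip Qid//; have [->|] := eqVneq j im; last by rewrite mulr1.
    by rewrite -val_eqE/= ltn_eqF// mul0r.
  - move=> j; rewrite mulmx_flip; have [->|jm] := eqVneq j im.
      by rewrite QN1 expr1 mulrNN mulr1 ?eqxx.
    by rewrite Qm0// mul0r.
move=> card_l QQ Qid.
have [|] := leqP #|[set j : 'I_n | (m < j)%N & (Q' im j != 0)%R]| l; first by move=> /IHl; exact.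
move=> /(leq_ltn_trans (leq0n _)); rewrite card_gt0 => /set0Pn[q]; rewrite inE => /andP[mq Qq].
pose r := Num.sqrt (Q' im im ^+ 2 + Q' im q ^+ 2).
have rr : r ^+ 2 = Q' im im ^+ 2 + Q' im q ^+ 2 by rewrite sqr_sqrtr// addr_ge0 ?sqr_ge0.
have r0 : r != 0.
  by rewrite -sqrf_eq0 rr gt_eqF// ltr_wpDl ?sqr_ge0// exprn_even_gt0.
(* The rotation that sends the entry in column [q] to 0. Its sine is nonzero because that entry is,
   as the factorization into shears demands. *)
pose c := Q' im im / r; pose s := - (Q' im q / r).
have cs : c ^+ 2 + s ^+ 2 = 1.
  by rewrite /c /s sqrrN !expr_div_n -mulrDl -rr divff// sqrf_eq0.
have s0 : s != 0 by rewrite oppr_eq0 mulf_neq0// invr_eq0.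
have imq : im != q by rewrite -val_eqE/= ltn_eqF.
apply: (Prem (givensK imq cs)).
  by apply: Pgivens => //; [rewrite oppr_eq0|rewrite sqrrN].
apply: IHl.
- rewrite -ltnS; apply: leq_trans card_l; apply: proper_card.
  apply/properP; split.
    apply/fintype.subsetP => j; rewrite !inE => /andP[mj].
    rewrite mulmx_givens mj/= -val_eqE/= gtn_eqF//.
    by have [->|] := eqVneq j q.
  exists q; rewrite !inE mq// mulmx_givens eqxx [q == _]eq_sym (negbTE imq) negbK.
  by rewrite /s /c; apply/eqP; ring.
- by rewrite trmx_mul mulmxA -(mulmxA Q') tr_givens// givensK// mulmx1.
- move=> i j im'; rewrite mulmx_givens !Qid// -!val_eqE/= (ltn_eqF im').
  rewrite (ltn_eqF (ltn_trans im' mq)).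
  rewrite !mulr0 subr0 addr0; case: eqVneq => [->|_]; first by rewrite ltn_eqF.
  by case: eqVneq => [->|_]//; rewrite (ltn_eqF (ltn_trans im' mq)).
Qed.

End OrthogonalInduction.

Lemma image_probability (R : realType) d d' (T : measurableType d) (U : measurableType d')
    (P : probability T R) (f : T -> U) : measurable_fun setT f ->
  exists Q : probability U R, forall S, Q S = P (f @^-1` S).
Proof.
move=> mf; pose X : {mfun T >-> U} := HB.pack f (isMeasurableFun.Build _ _ _ _ f mf).
by exists (distribution P X) => S.
Qed.

Lemma lebesgue_measure_opp {R : realType} (B : set R) : measurable B ->
  lebesgue_measure (-%R @^-1` B) = lebesgue_measure B.
Proof.
pose f : measurableTypeR R -> measurableTypeR R := -%R.
move=> mB; have mf : measurable_fun setT f by exact: oppr_measurable.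
apply/esym; apply: (lebesgue_measure_unique (mu := pushforward lebesgue_measure f)) => //.
move=> _ [[a b] _ <-].
transitivity (lebesgue_measure `[- b, - a[%classic); last first.
  congr (lebesgue_measure _); apply/seteqP; split=> y /=; rewrite !in_itv/=.
    by rewrite ltrNr lerNl andbC.
  by rewrite ltrNr lerNl andbC.
rewrite !lebesgue_measure_itv/= !lte_fin ltrN2; case: ifP => // _.
by rewrite -!EFinB; congr EFin; ring.
Qed.

(** * The law of a Gaussian matrix *)

Section GaussianLaw.
Context {R : realType} {k n : nat}.
Notation gam := (@normal_prob R 0 1).
Notation R1 := (measurableTypeR R).
Notation BM := (borel 'M[R]_(k, n)).

Lemma normal_prob_opp (B : set R1) : measurable B -> gam (-%R @^-1` B) = gam B.
Proof.
move=> mB; pose f : R1 -> R1 := -%R; pose g (x : R1) := (normal_pdf 0 1 x)%:E.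
transitivity (\int[lebesgue_measure]_(x in f @^-1` B) g (f x))%E.
  apply: eq_integral => x _; rewrite /g !normal_pdfE ?oner_eq0// /normal_fun.
  by rewrite !subr0 sqrrN.
apply: ge0_integral_preserving => //.
- exact: oppr_measurable.
- by move=> U mU; exact: lebesgue_measure_opp.
- by apply: measurable_funTS; apply/measurable_EFinP; exact: measurable_normal_pdf.
- by move=> x _; rewrite lee_fin normal_pdf_ge0.
Qed.

Implicit Types (G : probability BM R) (A : 'M[R]_(k, n)).

Definition gaussian_law G := forall B : 'I_k -> 'I_n -> set R,
  (forall i j, measurable (B i j)) ->
  G (rect B) = (\prod_(ij : 'I_k * 'I_n) gam (B ij.1 ij.2))%E.

Definition set_entry (i : 'I_k) (j : 'I_n) (t : R) A : 'M[R]_(k, n) :=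
  \matrix_(a, b) if (a, b) == (i, j) then t else A a b.

(** Frees one entry of a rectangle, so that the factor of that entry splits off its Gaussian
    mass. *)
Definition unbound (ij : 'I_k * 'I_n) (B : 'I_k -> 'I_n -> set R) a b :=
  if (a, b) == ij then setT else B a b.

Lemma measurable_unbound ij B : (forall i j, measurable (B i j)) ->
  forall i j, measurable (unbound ij B i j).
Proof. by move=> mB i j; rewrite /unbound; case: ifP. Qed.

Lemma gaussian_law_unbound G B ij : gaussian_law G ->
  (forall i j, measurable (B i j)) ->
  G (rect B) = (gam (B ij.1 ij.2) * G (rect (unbound ij B)))%E.
Proof.
move=> GG mB; rewrite !GG//; last exact: measurable_unbound.
rewrite (bigD1 ij)//= [in RHS](bigD1 ij)//=; congr (_ * _)%E.
rewrite /unbound -surjective_pairing eqxx probability_setT mul1e.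
by apply: eq_bigr => -[a b] /negbTE /= ->.
Qed.

Definition measure_preserving d (T : measurableType d) (P : probability T R) (r : T -> T) :=
  measurable_fun setT r /\ forall S, measurable S -> P (r @^-1` S) = P S.

Lemma measurable_set_entry i j (r : R1 -> R1) : measurable_fun setT r ->
  measurable_fun setT (fun z : R1 * BM => set_entry i j (r z.1) z.2 : BM).
Proof.
move=> mr; apply: measurable_mx => a b; under eq_fun do rewrite mxE.
case: eqP => _; first by apply: (measurableT_comp mr); exact: measurable_fst.
by apply: (measurableT_comp (measurable_entry a b)); exact: measurable_snd.
Qed.

(** Overwriting one entry by a fresh independent Gaussian value keeps the law. This gives Fubini
    arguments in a single entry without splitting the matrix space into a product. *)
Lemma gaussian_law_resample G i j r (S : set BM) : measure_preserving gam r ->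
  gaussian_law G -> measurable S ->
  (gam \x G)%E ((fun z => set_entry i j (r z.1) z.2) @^-1` S) = G S.
Proof.
move=> [mr rE] GG mS.
have [Q QE] := image_probability (gam \x G)%E (measurable_set_entry i j mr).
rewrite -QE; apply: eq_measure_rect mS => B mB.
rewrite QE (gaussian_law_unbound (i, j) GG mB).
rewrite -[gam (B _ _)]rE; last exact: mB.
rewrite -product_measure1E; last 2 first.
- by rewrite -[X in measurable X]setTI; apply: mr => //; exact: mB.
- by apply: measurable_rect; exact: measurable_unbound.
congr product_measure1; apply/seteqP; split=> -[t A] /=.
  move=> tA; split; first by have := tA i j; rewrite mxE eqxx.
  move=> a b; rewrite /unbound; have := tA a b; rewrite mxE; by case: ifP.
move=> [Bt Ar] a b; rewrite mxE; case: ifPn => [/eqP[-> ->]//|abij].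
by have := Ar a b; rewrite /unbound (negbTE abij).
Qed.

Lemma measurable_set_entry2 i p q (r : R1 * R1 -> R1 * R1) : measurable_fun setT r ->
  measurable_fun setT (fun z : (R1 * R1) * BM =>
    set_entry i p (r z.1).1 (set_entry i q (r z.1).2 z.2) : BM).
Proof.
move=> mr0; apply: measurable_mx => a b; under eq_fun do rewrite !mxE.
have mr : measurable_fun setT (fun z : (R1 * R1) * BM => r z.1).
  by apply: (measurableT_comp mr0); exact: measurable_fst.
case: eqP => _; first exact: (measurableT_comp measurable_fst mr).
case: eqP => _; first exact: (measurableT_comp measurable_snd mr).
by apply: (measurableT_comp (measurable_entry a b)); exact: measurable_snd.
Qed.

Lemma gaussian_law_resample2 G i p q r (S : set BM) : p != q ->
  measure_preserving (gam \x gam)%E r -> gaussian_law G -> measurable S ->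
  ((gam \x gam) \x G)%E ((fun z => set_entry i p (r z.1).1
     (set_entry i q (r z.1).2 z.2)) @^-1` S) = G S.
Proof.
move=> pq [mr rE] GG mS.
have [Q QE] := image_probability ((gam \x gam) \x G)%E (measurable_set_entry2 i p q mr).
rewrite -QE; apply: eq_measure_rect mS => B mB.
rewrite QE (gaussian_law_unbound (i, p) GG mB).
rewrite (gaussian_law_unbound (i, q) GG); last exact: measurable_unbound.
have -> : unbound (i, p) B (i, q).1 (i, q).2 = B i q.
  by rewrite /unbound /= xpair_eqE eqxx/= eq_sym (negbTE pq).
rewrite muleA /=.
have mBB : measurable (B i p `*` B i q : set (R1 * R1)).
  by apply: measurableX; exact: mB.
rewrite -product_measure1E; [|exact: mB..].
rewrite -(rE _ mBB) -product_measure1E; last 2 first.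
- by rewrite -[X in measurable X]setTI; apply: mr.
- by apply: measurable_rect; do 2 apply: measurable_unbound.
congr product_measure1; apply/seteqP; split=> -[t A] /=.
  move=> tA; split.
    split; first by have := tA i p; rewrite !mxE eqxx.
    by have := tA i q; rewrite !mxE !xpair_eqE !eqxx/= eq_sym (negbTE pq).
  move=> a b; rewrite /unbound; have := tA a b; rewrite !mxE; case: ifP => // _; by case: ifP.
move=> [[B1 B2] Ar] a b; rewrite !mxE; case: ifPn => [/eqP[-> ->]//|abij].
case: ifPn => [/eqP[-> ->]//|abij'].
by have := Ar a b; rewrite /unbound (negbTE abij) (negbTE abij').
Qed.

Definition mul_row (i : 'I_k) (Q : 'M[R]_n) A : 'M[R]_(k, n) :=
  \matrix_(a, b) if a == i then (A *m Q) a b else A a b.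

Lemma measurable_mulmxr (Q : 'M[R]_n) : measurable_fun setT (fun A : BM => A *m Q : BM).
Proof.
apply: measurable_mx => a b; under eq_fun do rewrite mxE.
apply: measurable_sum => l; apply: measurable_funM => //; exact: measurable_entry.
Qed.

Lemma measurable_mul_row i Q : measurable_fun setT (fun A : BM => mul_row i Q A : BM).
Proof.
apply: measurable_mx => a b; under eq_fun do rewrite mxE.
case: eqP => _; last exact: measurable_entry.
exact: (measurableT_comp (measurable_entry a b) (measurable_mulmxr Q)).
Qed.

Lemma gaussian_law_mul_row G i (Q : 'M[R]_n) : gaussian_law G -> Q^T *m Q = 1%:M ->
  forall S : set BM, measurable S -> G (mul_row i Q @^-1` S) = G S.
Proof.
move=> GG; apply: (orthogonal_ind (P := fun Q => forall S : set BM, measurable S ->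
  G (mul_row i Q @^-1` S) = G S)).
- move=> S _; congr (G _); apply/funext => A; rewrite /preimage/=; congr (S _).
  by apply/matrixP => a b; rewrite mxE mulmx1; case: ifP.
- move=> Q1 Q2 IH1 IH2 S mS; rewrite -[RHS]IH2// -[RHS]IH1; last first.
    by rewrite -[X in measurable X]setTI; exact: measurable_mul_row.
  congr (G _); apply/funext => A; rewrite /preimage/=; congr (S _).
  apply/matrixP => a b; rewrite [LHS]mxE [RHS]mxE; have [->|ai] := eqVneq a i; last first.
    by rewrite mxE (negbTE ai).
  rewrite mulmxA mxE [RHS]mxE; apply: eq_bigr => l _.
  by rewrite [in RHS]mxE eqxx.
- move=> p q c s pq s0 cs S mS.
  have idP : measure_preserving (gam \x gam)%E id by split.
  have rotP : measure_preserving (gam \x gam)%E (plane_rotation c s).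
    by split=> [|U mU]; [exact: measurable_plane_rotation|exact: gauss_rotation].
  (* Both sides are resampled in the entries [(i, p)] and [(i, q)], one with a rotated pair and one
     with the pair itself; the two preimages then coincide. *)
  rewrite -(gaussian_law_resample2 i pq rotP GG mS).
  rewrite -(gaussian_law_resample2 i pq idP GG); last first.
    by rewrite -[X in measurable X]setTI; exact: measurable_mul_row.
  congr product_measure1; apply/funext => -[[x y] A]; rewrite /preimage/=; congr (S _).
  apply/matrixP => a b; rewrite mxE mulmx_givens !mxE !xpair_eqE.
  have [->|_] := eqVneq a i => //=; rewrite !eqxx/=; rewrite [q == p]eq_sym (negbTE pq).
  by case: (b == p); case: (b == q).
- move=> p S mS.
  have idP : measure_preserving gam id by split.
  have oppP : measure_preserving gam -%R.
    by split=> [|U mU]; [exact: oppr_measurable|exact: normal_prob_opp].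
  rewrite -(gaussian_law_resample i p oppP GG mS).
  rewrite -(gaussian_law_resample i p idP GG); last first.
    by rewrite -[X in measurable X]setTI; exact: measurable_mul_row.
  congr product_measure1; apply/funext => -[x A]; rewrite /preimage/=; congr (S _).
  apply/matrixP => a b; rewrite mxE mulmx_flip !mxE !xpair_eqE.
  have [->|_] := eqVneq a i => //=.
  by case: eqP => _ /=; rewrite ?mulrN1 ?mulr1.
Qed.

Lemma gaussian_law_mulmxr G (Q : 'M[R]_n) : gaussian_law G -> Q^T *m Q = 1%:M ->
  forall S : set BM, measurable S -> G ((fun A => A *m Q) @^-1` S) = G S.
Proof.
move=> GG QQ.
(* The rows are multiplied by [Q] one after another; [uniq s] ensures that none is multiplied
   twice. *)
pose f (s : seq 'I_k) A := foldr (fun i => mul_row i Q) A s.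
have fE s A a b : uniq s -> f s A a b = if a \in s then (A *m Q) a b else A a b.
  elim: s a b => [//|i s IH] a b /= /andP[ins us].
  rewrite mxE in_cons; have [->|_] /= := eqVneq a i; last exact: IH.
  by rewrite !mxE; apply: eq_bigr => l _; rewrite IH// (negbTE ins).
have Gf s (S : set BM) : measurable S -> G (f s @^-1` S) = G S.
  elim: s S => [//|i s IH] S mS /=.
  rewrite -[RHS](gaussian_law_mul_row i GG QQ mS) -[RHS]IH//.
  by rewrite -[X in measurable X]setTI; exact: measurable_mul_row.
move=> S mS; rewrite -[RHS](Gf (enum 'I_k) _ mS); congr (G _).
apply/funext => A; rewrite /preimage/=; congr (S _); apply/matrixP => a b.
by rewrite fE ?enum_uniq// mem_enum.
Qed.

End GaussianLaw.

(** * Touching has probability zero *)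

Lemma null_bigcup_countable d (T : measurableType d) (R : realType) (I : countType)
    (mu : {measure set T -> \bar R}) (F : I -> set T) :
  (forall i, measurable (F i)) -> (forall i, mu (F i) = 0%E) -> mu (\bigcup_i F i) = 0%E.
Proof.
move=> mF F0; pose F' m := if unpickle m is Some i then F i else set0.
have mF' m : measurable (F' m) by rewrite /F'; case: unpickle.
have -> : \bigcup_i F i = \bigcup_m F' m.
  apply/seteqP; split=> [t [i _ Fi]|t [m _]].
    by exists (pickle i) => //; rewrite /F' pickleK.
  by rewrite /F'; case: unpickle => [i Fi|//]; exists i.
have : (mu (\bigcup_m F' m) <= \sum_(i <oo) mu (F' i))%E.
  by apply: le_mu_bigcup => //; exact: bigcupT_measurable.
rewrite eseries0 => [|m _ _]; last first.
  by rewrite /F'; case: unpickle => [i|]; [exact: F0|exact: measure0].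
by rewrite measure_le0 => /eqP.
Qed.

Section Touching.
Context {R : realType} {k n : nat}.
Notation gam := (@normal_prob R 0 1).
Notation BM := (borel 'M[R]_(k, n)).
Implicit Types (C : set 'cV[R]_n) (A : 'M[R]_(k, n)).

Definition supported C A (u : 'rV[R]_k) := forall c, C c -> 0 <= (u *m A *m c) ord0 ord0.

(** With [s] equal to 1 or -1, countably many such compact sets contain a positive multiple of every
    nonzero vector. *)
Definition cube (m : nat) (l : nat) (i : 'I_m) (s : R) : set 'rV[R]_m :=
  [set v | forall a, v ord0 a \in `[if a == i then s else - l%:R, if a == i then s else l%:R]].

Lemma closed_supported_cube C (l : nat) i s :
  closed [set A | exists2 u, cube l i s u & supported C A u].
Proof.
pose F : set ('M[R]_(k, n) * 'rV[R]_k) := [set z | supported C z.1 z.2].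
apply: (@closed_projection _ _ (cube l i s) F); first exact: compact_cube.
rewrite (_ : F = \bigcap_(c in C)
    [set z : 'M[R]_(k, n) * 'rV[R]_k | 0 <= (z.2 *m z.1 *m c) ord0 ord0]).
  apply: closed_bigI => c _; apply: closed_ge0.
  apply: entrywise_continuousM; last exact: entrywise_continuous_cst.
  apply: entrywise_continuousM; first exact: entrywise_continuous_snd.
  exact: entrywise_continuous_fst.
by apply/seteqP; split.
Qed.

Lemma closed_kernel_cube C (l : nat) (j : 'I_n) t : closed C ->
  closed [set A : 'M[R]_(k, n) | exists2 x, cube l j t x & C x^T /\ A *m x^T = 0].
Proof.
move=> cC.
pose F : set ('M[R]_(k, n) * 'rV[R]_n) := fun z => C (z.2)^T /\ z.1 *m (z.2)^T = 0.
apply: (@closed_projection 'M[R]_(k, n) 'rV[R]_n (cube l j t) F); first exact: compact_cube.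
rewrite (_ : F = [set z | C (z.2)^T] `&` [set z | z.1 *m (z.2)^T = 0])//; apply: closedI.
  apply: (@preimage_closed _ _ (fun z : 'M[R]_(k, n) * 'rV[R]_n => z.2^T)) => // z _.
  apply: (@continuous_comp _ _ _ snd (fun v : 'rV[R]_n => v^T)); first exact: cvg_snd.
  exact: continuous_trmx.
rewrite (_ : mkset _ = \bigcap_(i in [set: 'I_k])
    [set z : 'M[R]_(k, n) * 'rV[R]_n | ((z.1 : 'M[R]_(k, n)) *m z.2^T) i ord0 = 0]).
  apply: closed_bigI => i _; apply: closed_eq0.
  apply: entrywise_continuousM; first exact: entrywise_continuous_fst.
  by apply: entrywise_continuous_tr; exact: entrywise_continuous_snd.
apply/seteqP; split=> [z /= zE i _|z /= h]; first by rewrite /= zE mxE.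
by apply/colP => i; rewrite [RHS]mxE; exact: h.
Qed.

Lemma set_entryE i j t A : set_entry i j t A = A + (t - A i j) *: delta_mx i j.
Proof.
apply/matrixP => a b; rewrite !mxE xpair_eqE.
by case: eqP => [->|_]; case: eqP => [->|_] /=; rewrite ?mulr1 ?mulr0 ?addr0//; ring.
Qed.

Lemma delta_form (u : 'rV[R]_k) (x : 'cV[R]_n) i j :
  (u *m delta_mx i j *m x) ord0 ord0 = u ord0 i * x j ord0.
Proof.
rewrite -mulmxA mxE (bigD1 i)//= big1 ?addr0.
  congr (_ * _); rewrite mxE (bigD1 j)//= big1 ?addr0; first by rewrite mxE !eqxx mul1r.
  by move=> b bj; rewrite mxE (negbTE bj) andbF mul0r.
by move=> a ai; rewrite mxE big1 ?mulr0// => b _; rewrite mxE (negbTE ai) mul0r.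
Qed.

(* If [u] supports and [x] is in the kernel at parameter [a], and [v], [y] do so at [b],
   then pairing [u] with [y] gives [0 <= (a - b) s t] and pairing [v] with [x] gives
   [0 <= (b - a) s t]. *)
Lemma touching_line C A i j (s t : R) (l m : nat) (a b : R) : s != 0 -> t != 0 ->
  let T := [set A | exists2 u, cube l i s u & supported C A u] `&`
           [set A : 'M[R]_(k, n) | exists2 x, cube m j t x & C x^T /\ A *m x^T = 0] in
  T (set_entry i j a A) -> T (set_entry i j b A) -> a = b.
Proof.
move=> s0 t0 T [[u us uC] [x xt [Cx Ax]]] [[v vs vC] [y yt [Cy Ay]]].
have cubeE m' l' (i' : 'I_m') r w : cube l' i' r w -> w ord0 i' = r.
  by move=> /(_ i'); rewrite eqxx in_itv/= => /andP[h1 h2]; apply: le_anti; rewrite h1 h2.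
have := uC _ Cy; have := vC _ Cx.
rewrite (_ : set_entry i j a A = set_entry i j b A + (a - b) *: delta_mx i j); last first.
  by rewrite !set_entryE -addrA -scalerDl; congr (_ + _ *: _); ring.
have Ax' : set_entry i j b A *m x^T = (b - a) *: (delta_mx i j *m x^T).
  have -> : set_entry i j b A = set_entry i j a A + (b - a) *: delta_mx i j.
    by rewrite !set_entryE -addrA -scalerDl; congr (_ + _ *: _); ring.
  by rewrite mulmxDl Ax add0r scalemxAl.
rewrite -!mulmxA mulmxDl Ay add0r Ax' -scalemxAl -!scalemxAr !mulmxA.
rewrite [X in 0 <= X]mxE [X in _ -> 0 <= X -> _]mxE !delta_form !mxE.
rewrite (cubeE _ _ _ _ _ us) (cubeE _ _ _ _ _ vs) (cubeE _ _ _ _ _ xt) (cubeE _ _ _ _ _ yt).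
move=> h1 h2; have : (b - a) * (s * t) = 0.
  by apply: le_anti; rewrite h1 andbT -oppr_ge0 -mulNr opprB.
by move/eqP; rewrite !mulf_eq0 (negbTE s0) (negbTE t0) !orbF subr_eq0 => /eqP ->.
Qed.

Lemma normal_prob_set1 (a : R) : gam [set a] = 0%E.
Proof.
have /null_content_dominatesP h := @normal_prob_dominates R 0 1.
by apply: h; [exact: measurable_set1|exact: lebesgue_measure_set1].
Qed.

(** After resampling the entry [(i, j)], the section of [S] in that entry has at most one point,
    which has Gaussian mass 0; Tonelli concludes. *)
Lemma gaussian_law_null_lines (G : probability BM R) i j (S : set BM) :
  gaussian_law G -> measurable S ->
  (forall A a b, S (set_entry i j a A) -> S (set_entry i j b A) -> a = b) -> G S = 0%E.
Proof.
move=> GG mS S1.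
have idP : measure_preserving gam id by split.
have mE := measurable_set_entry i j (@measurable_id _ _ setT).
have mpre : measurable ((fun z : measurableTypeR R * BM => set_entry i j z.1 z.2) @^-1` S).
  by rewrite -[X in measurable X]setTI; exact: mE.
rewrite -(gaussian_law_resample i j idP GG mS).
transitivity ((gam \x^ G)%E ((fun z : measurableTypeR R * BM => set_entry i j z.1 z.2) @^-1` S)).
  by apply: product_measure_unique => // *; exact: product_measure2E.
apply: integral0_eq => A _ /=; apply/eqP; rewrite eq_le measure_ge0 andbT.
set Y := ysection _ _.
have mY : measurable Y by exact: measurable_ysection.
have [->|/set0P[a Ya]] := eqVneq Y set0; first by rewrite measure0.
rewrite -(normal_prob_set1 a); apply: le_measure.
  by rewrite inE.
  by rewrite inE; exact: measurable_set1.
by move=> b Yb /=; move: Ya Yb; rewrite /Y /ysection/= !inE/= => Ya Yb; exact: S1 Yb Ya.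
Qed.

Lemma cube_normalization m (v : 'rV[R]_m) : v != 0 ->
  exists (i : 'I_m) (b : bool) (l : nat) (a : R), 0 < a /\ cube l i ((-1) ^+ b) (a *: v).
Proof.
move=> /rV0Pn[i vi]; exists i, (v ord0 i < 0).
(* Dividing by [|v_i|] leaves the sign of [v_i] at [i]; the integer exceeds the sum of the absolute
   values of all scaled entries. *)
exists (Num.truncn (\sum_j `|v ord0 j| / `|v ord0 i|)).+1, `|v ord0 i|^-1.
split; first by rewrite invr_gt0 normr_gt0.
move=> j; rewrite mxE; have [->|ji] := eqVneq j i.
  have -> : `|v ord0 i|^-1 * v ord0 i = (-1) ^+ (v ord0 i < 0)%R.
    by rewrite {2}(realEsign (num_real (v ord0 i))) mulrCA mulVf ?mulr1// normr_eq0.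
  by rewrite in_itv/= lexx.
rewrite in_itv/= -ler_norml normrM normfV normr_id mulrC.
apply: le_trans (ltW (truncnS_gt _)); rewrite (bigD1 j)//= lerDl.
by apply: sumr_ge0 => *; rewrite divr_ge0.
Qed.

Definition meets_kernel C := [set A : 'M[R]_(k, n) | exists2 x, x != 0 & C x /\ A *m x = 0].

Definition has_support C := [set A : 'M[R]_(k, n) | exists2 u : 'rV[R]_k, u != 0 & supported C A u].

Lemma meets_kernel_bigcup C : (forall a x, 0 < a -> C x -> C (a *: x)) ->
  meets_kernel C = \bigcup_(z : 'I_n * bool * nat)
    [set A : 'M[R]_(k, n) | exists2 x, cube z.2 z.1.1 ((-1) ^+ z.1.2) x & C x^T /\ A *m x^T = 0].
Proof.
move=> CZ; apply/seteqP; split=> [A [x x0 [Cx Ax]]|A [[[j b] l] _ [x xc [Cx Ax]]]].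
  have xT0 : x^T != 0 by rewrite -trmx_eq0 trmxK.
  have [j [b [l [a [a0 xc]]]]] := cube_normalization xT0.
  exists ((j, b), l) => //; exists (a *: x^T) => //.
  by rewrite linearZ/= trmxK -scalemxAr Ax scaler0; split=> //; exact: CZ.
exists x^T => //; apply: contraTneq (xc j) => /= /(congr1 trmx); rewrite trmxK trmx0 => ->.
by rewrite mxE eqxx in_itv/= -eq_le signr_eq0.
Qed.

Lemma measurable_meets_kernel C : (forall a x, 0 < a -> C x -> C (a *: x)) -> closed C ->
  measurable (meets_kernel C : set BM).
Proof.
move=> CZ clC; rewrite meets_kernel_bigcup//.
apply: countable_bigcupT_measurable => // z; apply: measurable_closed.
exact: closed_kernel_cube.
Qed.

(** The normalized functional and the normalized kernel vector range over countably many pairs of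
    cubes; for each pair the touching matrices form a closed set that meets every line in direction
    [(i, j)] at most once. *)
Lemma touching_null (G : probability BM R) C : gaussian_law G ->
  (forall a x, 0 < a -> C x -> C (a *: x)) -> closed C ->
  exists2 N : set BM, measurable N & G N = 0%E /\ has_support C `&` meets_kernel C `<=` N.
Proof.
move=> GG CZ clC.
pose I : countType := (('I_k * 'I_n) * (bool * bool) * (nat * nat))%type.
pose F (z : I) : set BM :=
  [set A | exists2 u, cube z.2.1 z.1.1.1 ((-1) ^+ z.1.2.1) u & supported C A u] `&`
  [set A : 'M[R]_(k, n) |
    exists2 x, cube z.2.2 z.1.1.2 ((-1) ^+ z.1.2.2) x & C x^T /\ A *m x^T = 0].
have mF z : measurable (F z).
  apply: measurableI; apply: measurable_closed.
    exact: closed_supported_cube.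
  exact: closed_kernel_cube.
have F0 z : G (F z) = 0%E.
  apply: (gaussian_law_null_lines (i := z.1.1.1) (j := z.1.1.2)) => //.
  by move=> A a b; apply: touching_line; rewrite signr_eq0.
exists (\bigcup_z F z); first exact: countable_bigcupT_measurable.
split; first exact: null_bigcup_countable.
move=> A [[u u0 uC]]; rewrite meets_kernel_bigcup// => -[[[j b'] l'] _ kA].
have [i [b [l [a [a0 uc]]]]] := cube_normalization u0.
exists ((i, j), (b, b'), (l, l')) => //; split => //=.
exists (a *: u) => // c Cc; rewrite -!scalemxAl mxE mulr_ge0 ?(ltW a0)//.
exact: uC.
Qed.

End Touching.

(** * Uniqueness of uniformly distributed probabilities *)

Section UniformProbability.
Context {R : realType} {n : nat}.
Notation BM := (borel 'M[R]_n).
Implicit Types (X Y Z : 'M[R]_n) (P : probability BM R).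

(** The squared Frobenius distance, chosen because orthogonal conjugation preserves it; radii of
    [fball] are therefore squared radii. *)
Definition frob X Y : R := \sum_(ij : 'I_n * 'I_n) (X ij.1 ij.2 - Y ij.1 ij.2) ^+ 2.

Definition fball X (r : R) : set 'M[R]_n := [set Y | frob X Y < r].

Lemma frobC X Y : frob X Y = frob Y X.
Proof. by apply: eq_bigr => ij _; rewrite -sqrrN opprB. Qed.

Lemma frobxx X : frob X X = 0.
Proof. by rewrite /frob big1// => ij _; rewrite subrr expr0n. Qed.

Lemma continuous_frob X : continuous (frob X).
Proof.
apply: continuous_sum => ij Y.
have h : continuous (fun Y : 'M[R]_n => X ij.1 ij.2 - Y ij.1 ij.2).
  move=> Z; apply: (@continuousB R R^o _ (fun=> X ij.1 ij.2) (fun Y : 'M[R]_n => Y ij.1 ij.2)).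
    exact: cst_continuous.
  exact: coord_continuous.
exact: (continuousM (h Y) (h Y)).
Qed.

Lemma open_fball X r : open (fball X r).
Proof.
apply: (@open_comp _ _ (frob X) [set x : R | x < r]) => [Y _|]; first exact: continuous_frob.
exact: open_lt.
Qed.

Lemma measurable_frob : measurable_fun setT (fun z : BM * BM => frob z.1 z.2).
Proof.
apply: measurable_sum => ij; apply: measurable_funX; apply: measurable_funB.
  by apply: (measurableT_comp (measurable_entry ij.1 ij.2)); exact: measurable_fst.
by apply: (measurableT_comp (measurable_entry ij.1 ij.2)); exact: measurable_snd.
Qed.

Lemma probability1_setI d (T : measurableType d) (Q : probability T R) (A D : set T) :
  measurable A -> measurable D -> Q D = 1%E -> Q (A `&` D) = Q A.
Proof.
move=> mA mD QD; apply/eqP; rewrite eq_le; apply/andP; split.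
  by apply: le_measure; rewrite ?inE//; exact: measurableI.
have mAD : measurable (A `&` D) by exact: measurableI.
have mAD' : measurable (A `\` D) by exact: measurableD.
have := measureU2 Q mAD mAD'; rewrite setUIDK => /le_trans; apply.
rewrite -[leRHS]adde0; apply: leeD => //.
have -> : 0%E = Q (~` D) by rewrite probability_setC// QD subee.
apply: le_measure; rewrite ?inE//; exact: measurableC.
Qed.

Definition uniform_on (D : set 'M[R]_n) P :=
  P D = 1%E /\ forall r X Y, 0 < r -> D X -> D Y -> P (fball X r) = P (fball Y r).

(** If one ball were null, all balls of that radius centred in [D] would be, and countably many
    small boxes, each null on [D], would cover [D]. *)
Lemma uniform_fball_gt0 (D : set BM) P X r : measurable D ->
  uniform_on D P -> D X -> 0 < r -> (0 < P (fball X r))%E.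
Proof.
move=> mD [PD PE] DX r0; rewrite lt_def measure_ge0 andbT; apply/eqP => P0.
(* Bounds [frob] on a box: each of the [n^2] entries differs by less than twice the box radius. *)
have [N Nr] : exists N : nat, n%:R ^+ 2 * (2 * N.+1%:R^-1) ^+ 2 < r.
  pose K := n%:R ^+ 2 * 4 / r; exists (Num.truncn K).
  have K0 : 0 <= K by rewrite divr_ge0// ?ltW// mulr_ge0// sqr_ge0.
  have T1 : 1 <= (Num.truncn K).+1%:R :> R by rewrite ler1n.
  have : K < (Num.truncn K).+1%:R by exact: truncnS_gt.
  move: T1; move: ((Num.truncn K).+1%:R) => t t1 Kt.
  have t0 : 0 < t by lra.
  rewrite exprMn exprVn mulrA ltr_pdivrMr ?exprn_gt0//.
  have : n%:R ^+ 2 * 4 < t * r by rewrite -ltr_pdivrMr.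
  have : t * r <= t ^+ 2 * r by rewrite ler_pM2r// expr2 ler_peMl// ltW.
  by rewrite (_ : 2 ^+ 2 = 4) 1?mulrC//; [lra|rewrite expr2; lra].
have : P (\bigcup_(q : 'M[rat]_n) (rat_box (q, N) `&` D)) = 0%E.
  apply: null_bigcup_countable => q.
    by apply: measurableI => //; apply: measurable_rect => i j; exact: measurable_ball.
  have [->|/set0P[Y [qY DY]]] := eqVneq (rat_box (q, N) `&` D) set0; first by rewrite measure0.
  apply/eqP; rewrite -measure_le0 -[leRHS]P0 (PE r X Y r0 DX DY).
  have mqD : measurable (rat_box (q, N) `&` D : set BM).
    by apply: measurableI => //; apply: measurable_rect => i j; exact: measurable_ball.
  have mb : measurable (fball Y r : set BM) by by apply: measurable_open; exact: open_fball.
  apply: le_measure; rewrite ?inE//.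
  move=> Z [qZ _]; rewrite /fball/=; apply: le_lt_trans Nr.
  have -> : n%:R ^+ 2 * (2 * N.+1%:R^-1) ^+ 2 = \sum_(ij : 'I_n * 'I_n) (2 * N.+1%:R^-1) ^+ 2 :> R.
    by rewrite sumr_const card_prod card_ord -[RHS]mulr_natl natrM; ring.
  apply: ler_sum => -[i j] _ /=; rewrite -[leLHS]real_normK ?num_real// lerXn2r ?nnegrE//.
  have := qY i j; have := qZ i j; rewrite /ball/= !ltr_norml ler_norml.
  by move: (N.+1%:R^-1) => d /andP[h1 h2] /andP[h3 h4]; apply/andP; split; lra.
suff -> : \bigcup_(q : 'M[rat]_n) (rat_box (q, N) `&` D) = D.
  by rewrite PD => -[] /eqP; rewrite oner_eq0.
rewrite -setI_bigcupl setIidr// => Y _; have [q qY] := rat_box_cover N Y.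
by exists q.
Qed.

(* Counting the pairs [(x, y)] with [x] in [V] and [y] in the ball around [x] in the
   two possible orders. *)
Lemma uniform_double_counting (D V U : set BM) P Q X r : measurable D -> measurable V ->
  measurable U -> uniform_on D P -> uniform_on D Q -> D X -> 0 < r ->
  V `<=` D -> (forall x, V x -> fball x r `<=` U) ->
  (Q (fball X r) * P V <= P (fball X r) * Q U)%E.
Proof.
move=> mD mV mU [PD PE] [QD QE] DX r0 VD VU.
pose S : set (BM * BM) := (V `*` D) `&` [set z | frob z.1 z.2 < r].
have mS : measurable S.
  apply: measurableI; first exact: measurableX.
  rewrite (_ : mkset _ = (fun z : BM * BM => frob z.1 z.2) @^-1` `]-oo, r[); last first.
    by apply/seteqP; split=> z /=; rewrite in_itv.
  by rewrite -[X in measurable X]setTI; apply: measurable_frob => //; exact: measurable_itv.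
(* Integrating over [x] first bounds the left side from above by the mass of [S]; integrating over
   [y] first bounds this mass by the right side. *)
have E : (P \x Q)%E S = (P \x^ Q)%E S.
  by apply: product_measure_unique => // *; exact: product_measure2E.
apply: (@le_trans _ _ ((P \x Q)%E S)).
  rewrite -integral_cst// [leLHS]integral_mkcond; apply: ge0_le_integral => //.
  - by move=> x _; rewrite patchE; case: ifP.
  - by apply/(measurable_restrictT _ mV); exact: measurable_cst.
  - exact: measurable_fun_xsection.
  move=> x _; rewrite patchE; case: ifPn => [|_]; last exact: measure_ge0.
  rewrite inE => Vx /=; rewrite (QE r X x r0 DX (VD _ Vx)).
  rewrite -(probability1_setI (measurable_open (@open_fball x r)) mD QD).
  apply: le_measure; rewrite ?inE.
  - apply: measurableI => //; by apply: measurable_open; exact: open_fball.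
  - exact: measurable_xsection.
  by move=> y [xy Dy]; rewrite /xsection/= inE.
rewrite E -integral_cst// [leRHS]integral_mkcond; apply: ge0_le_integral => //.
- exact: measurable_fun_ysection.
- by apply/(measurable_restrictT _ mU); exact: measurable_cst.
move=> y _ /=; rewrite patchE; have [|yU] := boolP (y \in U).
  rewrite inE => Uy; have [Dy|nDy] := pselect (D y).
    rewrite (PE r X y r0 DX Dy); apply: le_measure; rewrite ?inE.
    + exact: measurable_ysection.
    + by apply: measurable_open; exact: open_fball.
    by move=> x; rewrite /ysection/= inE => -[_]; rewrite /fball/= frobC.
  rewrite (_ : ysection S y = set0) ?measure0//.
  by apply/seteqP; split=> // x; rewrite /ysection/= inE => -[[_ /= Dy]].
rewrite (_ : ysection S y = set0) ?measure0//.
apply/seteqP; split=> // x; rewrite /ysection/= inE => -[[/= Vx _] xy].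
by move: yU; rewrite notin_setE; apply; exact: VU Vx _ xy.
Qed.

(** Double counting is applied to the points of [D] whose ball of a given radius stays in [U]. The
    common ball mass cancels, being positive, and these sets increase to [U] within [D] as the
    radius shrinks. *)
Lemma uniform_le_open (D : set BM) P Q (U : set 'M[R]_n) : measurable D ->
  uniform_on D P -> uniform_on D Q -> open U -> (P U <= Q U)%E.
Proof.
move=> mD uP uQ oU; have [PD _] := uP; have [QD _] := uQ.
have [X DX] : exists X, D X.
  apply/not_existsP => D0; have D00 : D = set0 by apply/seteqP; split=> // x /D0.
  by move: PD; rewrite D00 measure0 => -[] /eqP; rewrite eq_sym oner_eq0.
have mU : measurable (U : set BM) by exact: measurable_open.
(* Double counting with [V = D] and the whole space for [U], in both directions. *)
have PQ r : 0 < r -> P (fball X r) = Q (fball X r).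
  move=> r0; apply/eqP; rewrite eq_le.
  have sT x : D x -> fball x r `<=` setT by [].
  have := uniform_double_counting mD mD measurableT uQ uP DX r0 (@subset_refl _ _) sT.
  have := uniform_double_counting mD mD measurableT uP uQ DX r0 (@subset_refl _ _) sT.
  by rewrite PD QD !mule1 => h1 h2; apply/andP; split; [move: h2|move: h1];
    rewrite (probability_setT Q, probability_setT P) ?mule1.
pose V (N : nat) : set BM := [set x | fball x N.+1%:R^-1 `<=` U] `&` D.
have mV N : measurable (V N).
  apply: measurableI => //; apply: measurable_closed.
  rewrite (_ : mkset _ = ~` \bigcup_(y in ~` U) fball y N.+1%:R^-1).
    by apply: open_closedC; apply: bigcup_open => y _; exact: open_fball.
  apply/seteqP; split=> x /=; first by move=> xU [y nUy yx]; apply/nUy/xU; rewrite /fball/= frobC.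
  by move=> h y xy; apply: contrapT => nUy; apply: h; exists y => //; rewrite /fball/= frobC.
have V_le N : (P (V N) <= Q U)%E.
  have N0 : 0 < N.+1%:R^-1 :> R by rewrite invr_gt0.
  have VU x : V N x -> fball x N.+1%:R^-1 `<=` U by case.
  have := uniform_double_counting mD (mV N) mU uP uQ DX N0 (@subIsetr _ _ _) VU.
  rewrite PQ// lee_pmul2l//; last exact: uniform_fball_gt0 uQ DX N0.
  by apply: fin_num_measure; apply: measurable_open; exact: open_fball.
have UV : U `&` D = \bigcup_N V N.
  apply/seteqP; split=> [x [Ux Dx]|x [N _ [xU Dx]]]; last first.
    by split=> //; apply: xU; rewrite /fball/= frobxx invr_gt0.
  have /nbhs_ballP[e /= e0 eU] : nbhs x U by apply: open_nbhs_nbhs.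
  exists (Num.truncn (e ^+ 2)^-1) => //; split=> // y xy; apply: eU; split=> // i j.
  rewrite /ball/= -ltr_sqr ?nnegrE ?(ltW e0)// real_normK ?num_real//.
  apply: (@le_lt_trans _ _ (frob x y)).
    rewrite /frob (bigD1 (i, j))//= lerDl.
    by apply: sumr_ge0 => ij _; exact: sqr_ge0.
  apply: lt_trans xy _; rewrite invf_plt ?posrE ?exprn_gt0//.
  exact: truncnS_gt.
rewrite -(probability1_setI mU mD PD) UV.
have ndV : nondecreasing_seq V.
  move=> N M NM; apply/subsetPset => x [xU Dx]; split=> // y xy; apply: xU.
  apply: lt_le_trans xy _; rewrite lef_pV2 ?posrE// ler_nat ltnS.
  by [].
have cvgV : P (V N) @[N --> \oo] --> P (\bigcup_N V N).
  exact: (nondecreasing_cvg_mu mV (bigcupT_measurable _ mV) ndV).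
rewrite -(cvg_lim _ cvgV)//; apply: lime_le; first by apply/cvg_ex; eexists; exact: cvgV.
by apply: nearW => N; exact: V_le.
Qed.

Lemma uniform_unique (D : set BM) P Q : measurable D ->
  uniform_on D P -> uniform_on D Q -> forall S, measurable S -> P S = Q S.
Proof.
move=> mD uP uQ; apply: (@measure_unique _ R BM open (fun=> setT)) => //.
- exact: openI.
- by move=> _; exact: openT.
- by rewrite bigcup_const.
- by move=> U oU; apply/eqP; rewrite eq_le !(uniform_le_open (D := D)).
- by move=> _; rewrite [ltLHS](probability_setT P) ltry.
Qed.

End UniformProbability.

(** * Projections and the Grassmannian *)

Section Projections.
Context {R : realType}.

Lemma trmx_mulmx_self_ge0 n (x : 'cV[R]_n) : 0 <= (x^T *m x) ord0 ord0.
Proof. by rewrite mxE; apply: sumr_ge0 => i _; rewrite mxE -expr2 sqr_ge0. Qed.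

Lemma trmx_mulmx_self_eq0 n (x : 'cV[R]_n) : (x^T *m x) ord0 ord0 = 0 -> x = 0.
Proof.
rewrite mxE => /eqP; rewrite psumr_eq0 => [/allP h|i _]; last by rewrite mxE -expr2 sqr_ge0.
apply/colP => i; rewrite mxE; have := h i; rewrite mem_index_enum => /(_ isT).
by rewrite mxE -expr2 sqrf_eq0 => /eqP.
Qed.

Lemma mulmx_tr_self_eq0 m n (A : 'M[R]_(m, n)) : A *m A^T = 0 -> A = 0.
Proof.
move=> AA; apply/row_matrixP => i; rewrite row0; apply: trmx_inj; rewrite trmx0.
apply: trmx_mulmx_self_eq0; transitivity ((A *m A^T) i i); last by rewrite AA mxE.
by rewrite !mxE; apply: eq_bigr => l _; rewrite !mxE.
Qed.

(* Splitting off a unit vector of the range lowers the rank. *)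
Lemma projection_factor n (W : 'M[R]_n) : W^T = W -> W *m W = W ->
  exists (r : nat) (B : 'M[R]_(r, n)), B *m B^T = 1%:M /\ B^T *m B = W.
Proof.
have [r] := ubnP (\rank W); elim: r W => // r IHr W rW WT WW.
have [->|W0] := eqVneq W 0.
  by exists 0%N, 0; rewrite trmx0 mul0mx; split; [apply/matrixP => -[]|rewrite mulmx0].
have [j Wj] : exists j, col j W != 0.
  apply/existsP; apply: contra_neqT W0 => /existsPn h.
  by apply/matrixP => i j; have /negPn/eqP/colP/(_ i) := h j; rewrite !mxE.
pose a := Num.sqrt (((col j W)^T *m col j W) ord0 ord0).
have aa : a ^+ 2 = ((col j W)^T *m col j W) ord0 ord0 by rewrite sqr_sqrtr// trmx_mulmx_self_ge0.
have a0 : a != 0 by rewrite -sqrf_eq0 aa; apply: contra_neq Wj; exact: trmx_mulmx_self_eq0.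
pose v := a^-1 *: col j W.
have vv : v^T *m v = 1%:M.
  rewrite /v [(_ *: _)^T]linearZ/= -scalemxAl -scalemxAr scalerA [LHS]mx11_scalar mxE -aa.
  by rewrite -expr2 exprVn mulVf ?sqrf_eq0.
have Wv : W *m v = v by rewrite /v -scalemxAr colE mulmxA WW.
have vW : v^T *m W = v^T by rewrite -[W in LHS]WT -trmx_mul Wv.
pose W' := W - v *m v^T.
have W'T : W'^T = W' by rewrite /W' linearB/= WT trmx_mul trmxK.
have W'W : W' *m W = W' by rewrite /W' mulmxBl WW -mulmxA vW.
have W'v : W' *m v = 0 by rewrite /W' mulmxBl Wv -mulmxA vv mulmx1 subrr.
have W'W' : W' *m W' = W'.
  by rewrite {2}/W' mulmxBr W'W mulmxA W'v mul0mx subr0.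
have rW' : (\rank W' < r)%N.
  rewrite -ltnS; apply: leq_trans rW; rewrite ltnS; apply: rank_ltmx.
  rewrite ltmxE -[X in (X <= _)%MS]W'W submxMl/=; apply/negP => /submxP[D WD].
  have : W *m v = 0 by rewrite WD -mulmxA W'v mulmx0.
  rewrite Wv => v0; have /matrixP/(_ ord0 ord0) := vv; rewrite v0 mulmx0 !mxE => /eqP.
  by rewrite eq_sym oner_eq0.
have [s [B [BB BW]]] := IHr _ rW' W'T W'W'.
have Bv : B *m v = 0.
  have : B *m (W' *m v) = 0 by rewrite W'v mulmx0.
  by rewrite -BW -mulmxA mulmxA BB mul1mx.
exists (s + 1)%N, (col_mx B v^T); split.
  rewrite tr_col_mx mul_col_row trmxK BB Bv vv.
  have -> : v^T *m B^T = 0 by rewrite -trmx_mul Bv trmx0.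
  by rewrite -scalar_mx_block.
by rewrite tr_col_mx mul_row_col trmxK BW /W' subrK.
Qed.

Lemma projection_factor_rank r n (B : 'M[R]_(r, n)) (W : 'M[R]_n) :
  B *m B^T = 1%:M -> B^T *m B = W -> \rank W = r.
Proof.
move=> BB BW; apply/eqP; rewrite eqn_leq; apply/andP; split.
  by rewrite -BW; apply: leq_trans (mxrankM_maxr _ _) (rank_leq_row _).
have -> : r = \rank (B *m B^T) by rewrite BB mxrank1.
apply: leq_trans (mxrankM_maxl _ _) _.
have {1}-> : B = B *m W by rewrite -BW mulmxA BB mul1mx.
exact: mxrankM_maxr.
Qed.

Lemma projection_trace n (W : 'M[R]_n) : W^T = W -> W *m W = W -> \tr W = (\rank W)%:R.
Proof.
move=> WT WW; have [r [B [BB BW]]] := projection_factor WT WW.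
by rewrite (projection_factor_rank BB BW) -BW mxtrace_mulC BB mxtrace1.
Qed.

Lemma rank_1sub_projection n (W : 'M[R]_n) : W^T = W -> W *m W = W ->
  \rank (1%:M - W) = (n - \rank W)%N.
Proof.
move=> WT WW.
have : (\rank (1%:M - W) + \rank W)%:R = n%:R :> R.
  rewrite natrD -!projection_trace//; last 2 first.
  - by rewrite linearB/= trmx1 WT.
  - by rewrite mulmxBl mul1mx mulmxBr mulmx1 WW subrr subr0.
  by rewrite linearB/= mxtrace1 subrK.
by move/eqP; rewrite eqr_nat => /eqP E; rewrite -[RHS](congr1 (subn^~ (\rank W)) E) addnK.
Qed.

(** Transitivity of the orthogonal group: orthonormal bases of the range of [W] and of its
    complement are sent to those of [V]. *)
Lemma projections_conjugate n (W V : 'M[R]_n) : W^T = W -> W *m W = W ->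
  V^T = V -> V *m V = V -> \rank W = \rank V ->
  exists Q : 'M[R]_n, Q^T *m Q = 1%:M /\ Q *m W *m Q^T = V.
Proof.
move=> WT WW VT VV.
have pc (U : 'M[R]_n) : U^T = U -> U *m U = U ->
    (1%:M - U)^T = 1%:M - U /\ (1%:M - U) *m (1%:M - U) = 1%:M - U.
  move=> UT UU; split; first by rewrite linearB/= trmx1 UT.
  by rewrite mulmxBl mul1mx mulmxBr mulmx1 UU subrr subr0.
have [W1T W1W] := pc _ WT WW; have [V1T V1V] := pc _ VT VV.
move=> rWV.
have rWV1 : \rank (1%:M - W) = \rank (1%:M - V) by rewrite !rank_1sub_projection// rWV.
have [r [B [BB BW]]] := projection_factor WT WW.
have [r' [B' [BB' BW']]] := projection_factor W1T W1W.
have [s [N [NN NV]]] := projection_factor VT VV.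
have [s' [N' [NN' NV']]] := projection_factor V1T V1V.
have rs : s = r by rewrite -(projection_factor_rank BB BW) -(projection_factor_rank NN NV).
have rs' : s' = r' by rewrite -(projection_factor_rank BB' BW') -(projection_factor_rank NN' NV').
subst s s'.
have NN'0 : N *m N'^T = 0.
  have -> : N *m N'^T = (N *m V) *m ((1%:M - V) *m N'^T).
    by rewrite -NV' -NV !mulmxA NN mul1mx -!mulmxA NN' mulmx1.
  by rewrite !mulmxA -(mulmxA N) mulmxBr mulmx1 VV subrr mulmx0 mul0mx.
have BB'0 : B' *m B^T = 0.
  have -> : B' *m B^T = (B' *m (1%:M - W)) *m (W *m B^T).
    by rewrite -BW' -BW !mulmxA BB' mul1mx -!mulmxA BB mulmx1.
  by rewrite !mulmxA -(mulmxA B') mulmxBl mul1mx WW subrr mulmx0 mul0mx.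
have N'N0 : N' *m N^T = 0 by rewrite -[N']trmxK -trmx_mul NN'0 trmx0.
exists (N^T *m B + N'^T *m B'); split.
  rewrite [(_ + _)^T]linearD/= !trmx_mul !trmxK mulmxDl !mulmxDr !mulmxA.
  rewrite -(mulmxA B^T N) -(mulmxA B^T N) -(mulmxA B'^T N') -(mulmxA B'^T N').
  rewrite NN NN' NN'0 N'N0 !mulmx0 !mul0mx !mulmx1 BW BW' addr0 add0r addrC subrK.
  by [].
have -> : (N^T *m B + N'^T *m B') *m W = N^T *m B.
  rewrite -BW mulmxDl !mulmxA -(mulmxA N^T) BB mulmx1.
  by rewrite -(mulmxA N'^T) BB'0 mulmx0 mul0mx addr0.
rewrite [(_ + _)^T]linearD/= !trmx_mul !trmxK mulmxDr !mulmxA -(mulmxA N^T B) BB mulmx1 NV.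
have BB'1 : B *m B'^T = 0 by rewrite -[B]trmxK -trmx_mul BB'0 trmx0.
by rewrite -(mulmxA N^T) BB'1 mulmx0 mul0mx addr0.
Qed.

End Projections.

(** * Haar measure and the projection onto the kernel *)

Section HaarGrassmannian.
Context {R : realType}.

Lemma frob_tr n (X Y : 'M[R]_n) : frob X Y = \tr ((X - Y)^T *m (X - Y)).
Proof.
rewrite /frob /mxtrace (eq_bigr (fun ij : 'I_n * 'I_n => (X - Y) ij.1 ij.2 ^+ 2)); last first.
  by move=> ij _; rewrite !mxE.
rewrite -(pair_bigA _ (fun i j => (X - Y) i j ^+ 2))/= exchange_big/=; apply: eq_bigr => j _.
by rewrite [RHS]mxE; apply: eq_bigr => i _; rewrite [(_^T) _ _]mxE expr2.
Qed.

Lemma frob_conjugate n (Q X Y : 'M[R]_n) : Q^T *m Q = 1%:M ->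
  frob (Q *m X *m Q^T) (Q *m Y *m Q^T) = frob X Y.
Proof.
move=> QQ; rewrite !frob_tr -mulmxBl -mulmxBr !trmx_mul trmxK.
rewrite !mulmxA -(mulmxA (Q *m (X - Y)^T)) QQ mulmx1 mxtrace_mulC !mulmxA QQ mul1mx.
by [].
Qed.

(** For a projection the rank is the trace, which is continuous, so the Grassmannian is closed. *)
Lemma grassmannianE n m : @grassmannian R n m =
  [set W | W^T - W = 0 /\ (W *m W - W = 0 /\ \tr W = m%:R)].
Proof.
apply/seteqP; split=> W /= [].
  by move=> WT WW <-; rewrite projection_trace// WT WW !subrr.
move=> /subr0_eq WT [/subr0_eq WW]; rewrite projection_trace// => /eqP.
by rewrite eqr_nat => /eqP.
Qed.

Lemma measurable_grassmannian n m : measurable (@grassmannian R n m : set (borel 'M[R]_n)).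
Proof.
have cid : entrywise_continuous (@id 'M[R]_n) by move=> i j; exact: coord_continuous.
have mx0 (f : 'M[R]_n -> 'M[R]_n) : entrywise_continuous f -> closed [set W | f W = 0].
  move=> cf; rewrite (_ : mkset _ = \bigcap_(ij in [set: 'I_n * 'I_n]) [set W | f W ij.1 ij.2 = 0]).
    by apply: closed_bigI => ij _; apply: closed_eq0; exact: cf.
  apply/seteqP; split=> [W /= fW ij _|W h]; first by rewrite /= fW mxE.
  by apply/matrixP => i j; rewrite [RHS]mxE; exact: (h (i, j)).
have ccB (f : 'M[R]_n -> 'M[R]_n) : entrywise_continuous f ->
    entrywise_continuous (fun W => f W - W).
  move=> cf i j W; rewrite (_ : (fun W => _) = (fun W : 'M[R]_n => f W i j - W i j)); last first.
    by apply/funext => V; rewrite !mxE.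
  by apply: (@continuousB R R^o); [exact: cf|exact: coord_continuous].
rewrite grassmannianE; apply: measurable_closed; apply: closedI.
  by apply/mx0/ccB; exact: entrywise_continuous_tr.
apply: closedI; first by apply/mx0/ccB; exact: entrywise_continuousM.
apply: (@preimage_closed _ _ (fun W : 'M[R]_n => \tr W) [set x : R | x = m%:R]).
  by move=> W _; apply: continuous_sum => i; exact: coord_continuous.
exact: closed_eq.
Qed.

Lemma is_haar_uniform n m (mu : probability (borel 'M[R]_n) R) :
  is_haar_grassmannian m mu -> uniform_on (@grassmannian R n m) mu.
Proof.
move=> [mu1 muQ]; split=> // r X Y r0 [XT XX Xm] [YT YY Ym].
have [Q [QQ QX]] := projections_conjugate XT XX YT YY (etrans Xm (esym Ym)).
rewrite -(muQ Q (fball Y r))//; last by apply: measurable_open; exact: open_fball.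
congr (mu _); apply/funext => W; rewrite /fball/=.
by rewrite -QX frob_conjugate.
Qed.

(** The orthogonal projection onto the kernel when [A] has full row rank. Otherwise [invmx] returns
    its argument, which for [k <= n] happens with Gaussian probability 0. *)
Definition kernel_projection k n (A : 'M[R]_(k, n)) : 'M[R]_n :=
  1%:M - A^T *m invmx (A *m A^T) *m A.

Lemma kernel_projection_mulmx k n (A : 'M[R]_(k, n)) (Q : 'M[R]_n) : Q^T *m Q = 1%:M ->
  kernel_projection (A *m Q^T) = Q *m kernel_projection A *m Q^T.
Proof.
move=> QQ; rewrite /kernel_projection trmx_mul trmxK mulmxBr mulmxBl mulmx1 (mulmx1C QQ).
by rewrite !mulmxA -(mulmxA A Q^T) QQ mulmx1.
Qed.

Section FullRank.
Context {k n : nat} (A : 'M[R]_(k, n)).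
Hypothesis A_unit : A *m A^T \in unitmx.

Lemma mulmx_kernel_projection : A *m kernel_projection A = 0.
Proof.
by rewrite /kernel_projection mulmxBr mulmx1 !mulmxA mulmxV// mul1mx subrr.
Qed.

Lemma kernel_projection_sym : (kernel_projection A)^T = kernel_projection A.
Proof.
rewrite /kernel_projection [(_ - _)^T]linearB/= trmx1 !trmx_mul trmxK trmx_inv.
by rewrite trmx_mul trmxK mulmxA.
Qed.

Lemma kernel_projection_idem : kernel_projection A *m kernel_projection A = kernel_projection A.
Proof.
rewrite {1}/kernel_projection mulmxBl mul1mx -!mulmxA mulmx_kernel_projection.
by rewrite !mulmx0 subr0.
Qed.

Lemma kernel_projectionP (x : 'cV[R]_n) : kernel_projection A *m x = x <-> A *m x = 0.
Proof.
split=> [<-|Ax]; first by rewrite mulmxA mulmx_kernel_projection mul0mx.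
by rewrite /kernel_projection mulmxBl mul1mx -!mulmxA Ax !mulmx0 subr0.
Qed.

Lemma rank_kernel_projection : \rank (kernel_projection A) = (n - k)%N.
Proof.
pose Pi := A^T *m invmx (A *m A^T) *m A.
have PiA : kernel_projection A = 1%:M - Pi by [].
have PiE : Pi = 1%:M - kernel_projection A by rewrite PiA opprB addrC subrK.
have PiT : Pi^T = Pi by rewrite PiE linearB/= trmx1 kernel_projection_sym.
have PiPi : Pi *m Pi = Pi.
  by rewrite PiE mulmxBl mul1mx mulmxBr mulmx1 kernel_projection_idem subrr subr0.
rewrite PiA rank_1sub_projection//; congr (_ - _)%N.
have APi : A *m Pi = A by rewrite PiE mulmxBr mulmx1 mulmx_kernel_projection subr0.
have rA : \rank A = k.
  apply/eqP; rewrite eqn_leq rank_leq_row/=.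
  by rewrite -{1}(mxrank_unit A_unit) mxrankM_maxl.
apply/eqP; rewrite eqn_leq; apply/andP; split.
  exact: leq_trans (mxrankM_maxr _ _) (rank_leq_row _).
by have := mxrankM_maxr A Pi; rewrite APi rA.
Qed.

End FullRank.

Lemma measurable_inv : measurable_fun setT (@GRing.inv R).
Proof.
have -> : [set: R] = [set 0] `|` [set x : R | x != 0].
  by apply/seteqP; split=> // x _; have [->|x0] := eqVneq x 0; [left|right].
have o : open [set x : R | x != 0] by exact: open_neq.
apply/measurable_funU; [exact: measurable_set1|exact: measurable_realfun.open_measurable|split].
  exact: measurable_fun_set1.
apply: open_continuous_measurable_fun => // x; rewrite inE => x0; exact: inv_continuous.
Qed.

Lemma measurable_kernel_projection k n :
  measurable_fun setT (fun A : borel 'M[R]_(k, n) => kernel_projection A : borel 'M[R]_n).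
Proof.
have mc (f : 'M[R]_(k, n) -> R) : continuous f -> measurable_fun setT (f : borel 'M[R]_(k, n) -> R).
  move=> cf; apply: (measurability _ (RGenOpens.measurableE R)).
  move=> _ [_ [a [b ->] <-]]; rewrite setTI; apply: measurable_open.
  by apply: open_comp; [move=> A _; exact: cf|exact: interval_open].
have cid : entrywise_continuous (@id 'M[R]_(k, n)) by move=> i j; exact: coord_continuous.
have cAA : entrywise_continuous (fun A : 'M[R]_(k, n) => A *m A^T).
  by apply: entrywise_continuousM => //; exact: entrywise_continuous_tr.
have mdet : measurable_fun setT (fun A : borel 'M[R]_(k, n) => \det (A *m A^T)).
  by apply: mc; exact: continuous_det.
have minv i j : measurable_fun setT (fun A : borel 'M[R]_(k, n) => invmx (A *m A^T) i j).
  (* Cramer's rule where the determinant is nonzero, the default value of [invmx] elsewhere. *)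
  rewrite (_ : (fun A => _) = (fun A : borel 'M[R]_(k, n) =>
      if \det (A *m A^T) == 0 then (A *m A^T) i j
      else (\det (A *m A^T))^-1 * \adj (A *m A^T) i j)); last first.
    by apply/funext => A; rewrite /invmx unitmxE unitfE; case: eqP => //= _; rewrite mxE.
  apply: measurable_fun_ifT.
  - apply: (measurable_fun_bool true); rewrite setTI.
    rewrite (_ : _ @^-1` _ =
      (fun A : borel 'M[R]_(k, n) => \det (A *m A^T)) @^-1` [set 0]); last first.
      by apply/seteqP; split=> A /= /eqP.
    by rewrite -[X in measurable X]setTI; exact: mdet.
  - by apply: mc; exact: cAA.
  - apply: measurable_funM; first by apply: (measurableT_comp measurable_inv).
    by apply: mc; exact: entrywise_continuous_adj.
apply: measurable_mx => i j; under eq_fun do rewrite !mxE.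
apply: measurable_funB => //; apply: measurable_sum => l.
apply: measurable_funM; last exact: measurable_entry.
under eq_fun do rewrite mxE; apply: measurable_sum => l'.
apply: measurable_funM; last exact: minv.
by under eq_fun do rewrite mxE; exact: measurable_entry.
Qed.

End HaarGrassmannian.

(** * Grassmann angles *)

Section GrassmannAngle.
Context {R : realType} {k n : nat}.
Notation BM := (borel 'M[R]_(k, n)).

Lemma not_subspace_witness (C : set 'cV[R]_n) : convex_cone C -> ~ is_linear_subspace C ->
  exists2 x, C x & ~ C (- x).
Proof.
move=> [C0 CD CZ] nC; apply: contrapT => nx; apply: nC.
have CN x : C x -> C (- x) by move=> Cx; apply: contrapT => nCx; apply: nx; exists x.
have CZ' a x : C x -> C (a *: x).
  move=> Cx; have [a0|/ltW a0] := leP 0 a; first exact: CZ.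
  by rewrite -[a]opprK scaleNr; apply/CN/CZ; rewrite ?oppr_ge0.
(* A vector space of maximal dimension inside [C] is all of [C], since adjoining another vector of
   [C] would keep it inside. *)
pose sub d := `[< exists W : {vspace 'cV[R]_n}, \dim W = d /\ [set` W] `<=` C >].
have ex0 : exists d, sub d.
  exists 0%N; apply/asboolP; exists 0%VS; rewrite dimv0; split=> // x /=.
  by rewrite memv0 => /eqP ->.
have ub d : sub d -> (d <= \dim (fullv : {vspace 'cV[R]_n}))%N.
  by move=> /asboolP[W [<- _]]; apply: dimvS; exact: subvf.
case: (ex_maxnP ex0 ub) => d /asboolP[W [Wd WC]] dmax.
exists W; apply/seteqP; split=> [x Cx /=|x]; last exact: WC.
have : (\dim (W + <[x]>) <= \dim W)%N.
  rewrite Wd; apply: dmax; apply/asboolP; exists (W + <[x]>)%VS; split=> // y /=.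
  move=> /memv_addP[w Ww [v /vlineP[a ->] ->]].
  by apply: CD; [exact: WC|exact: CZ'].
move=> dimW; have /eqP -> : W == (W + <[x]>)%VS by rewrite eqEdim addvSl.
exact: subvP (addvSr _ _) _ (memv_line _).
Qed.

Lemma mulmx_surj_row_free (A : 'M[R]_(k, n)) (C : set 'cV[R]_n) :
  [set A *m x | x in C] = setT -> row_free A.
Proof.
move=> AC; apply: inj_row_free => v vA.
have [x _ Ax] : [set A *m x | x in C] v^T by rewrite AC.
by apply: mulmx_tr_self_eq0; rewrite -Ax mulmxA vA mul0mx.
Qed.

Lemma unitmx_mulmx_tr (A : 'M[R]_(k, n)) : row_free A = (A *m A^T \in unitmx).
Proof.
rewrite -row_free_unit; apply/idP/idP => h.
  apply: inj_row_free => v vAA; apply: (row_free_inj h); rewrite mul0mx.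
  by apply: mulmx_tr_self_eq0; rewrite trmx_mul mulmxA -(mulmxA v) vAA mul0mx.
move: h; rewrite /row_free => /eqP h; rewrite eqn_leq rank_leq_row/=.
by rewrite -{1}h mxrankM_maxl.
Qed.

(** Touching with the whole space as cone: a rank-deficient matrix has a nonzero left kernel vector,
    which supports trivially, and, as [k <= n], a nonzero kernel vector. *)
Lemma gaussian_law_row_free (G : probability BM R) : gaussian_law G -> (k <= n)%N ->
  exists2 N : set BM, measurable N & G N = 0%E /\ [set A | ~~ row_free A] `<=` N.
Proof.
move=> GG kn; have [N mN [GN TN]] := touching_null GG (fun _ _ _ _ => I) (@closedT 'cV[R]_n).
exists N => //; split=> // A /= nfA; apply: TN; split.
  have /rowV0Pn[u uk u0] : kermx A != 0 by rewrite kermx_eq0.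
  exists u => // c _; have /sub_kermxP -> := uk.
  by rewrite mul0mx mxE.
have /rowV0Pn[x xk x0] : kermx A^T != 0.
  rewrite -mxrank_eq0 mxrank_ker mxrank_tr -lt0n subn_gt0.
  by apply: leq_trans kn; rewrite ltn_neqAle nfA rank_leq_row.
exists x^T; first by rewrite trmx_eq0.
by split=> //; apply: trmx_inj; rewrite trmx_mul trmxK trmx0; apply/sub_kermxP.
Qed.

Lemma is_haar_kernel_projection (G : probability BM R) (Q : probability (borel 'M[R]_n) R) :
  gaussian_law G -> (k <= n)%N ->
  (forall S, Q S = G ((fun A : BM => kernel_projection A) @^-1` S)) ->
  is_haar_grassmannian (n - k)%N Q.
Proof.
move=> GG kn QE; split.
  have [N mN [GN nN]] := gaussian_law_row_free GG kn.
  have mGr := @measurable_grassmannian R n (n - k)%N.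
  apply/eqP; rewrite eq_le; apply/andP; split; first exact: probability_le1.
  rewrite [leRHS]QE.
  have -> : 1%E = G (~` N) by rewrite probability_setC// GN sube0.
  apply: le_measure; rewrite ?inE.
  - exact: measurableC.
  - by rewrite -[X in measurable X]setTI; apply: measurable_kernel_projection.
  move=> A nNA /=; have uA : A *m A^T \in unitmx.
    by rewrite -unitmx_mulmx_tr; apply: contrapT => /negP nfA; apply: nNA; exact: nN.
  split; first exact: kernel_projection_sym.
    exact: kernel_projection_idem.
  exact: rank_kernel_projection.
move=> U B UU mB; rewrite !QE.
have UU' : (U^T)^T *m U^T = 1%:M by rewrite trmxK; exact: mulmx1C.
rewrite -[RHS](gaussian_law_mulmxr GG UU'); last first.
  by rewrite -[X in measurable X]setTI; exact: measurable_kernel_projection.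
congr (G _); apply/funext => A; rewrite /preimage/=; congr (B _).
by rewrite kernel_projection_mulmx.
Qed.

(** The law of the kernel projection shows that the choice behind [haar_grassmannian] has a witness;
    uniqueness identifies the two. *)
Lemma haar_grassmannianE (G : probability BM R) (S : set (borel 'M[R]_n)) :
  gaussian_law G -> (k <= n)%N -> measurable S ->
  haar_grassmannian R n (n - k)%N S = G ((fun A : BM => kernel_projection A) @^-1` S).
Proof.
move=> GG kn mS.
have [Q QE] := image_probability G (@measurable_kernel_projection R k n).
have haarQ := is_haar_kernel_projection GG kn QE.
have haarH : is_haar_grassmannian (n - k)%N (haar_grassmannian R n (n - k)%N).
  apply: (@getPex _ [set mu | is_haar_grassmannian (n - k)%N mu]).
  by exists Q.
rewrite -QE; apply: (uniform_unique (@measurable_grassmannian R n (n - k)%N)) => //;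
  exact: is_haar_uniform.
Qed.

(** The union of a countable measurable cover is itself a measurable superset of no larger mass than
    the cover. *)
Lemma mu_ext_le d (T : measurableType d) (mu : {measure set T -> \bar R}) (S : set T) (a : \bar R) :
  (forall B, measurable B -> S `<=` B -> (a <= mu B)%E) -> (a <= (mu^*)%mu S)%E.
Proof.
move=> aB; apply: le_ereal_inf_tmp => _ [F [mF SF] <-].
apply: le_trans (le_mu_bigcup mu mF _); last exact: bigcupT_measurable.
by apply: aB => //; exact: bigcupT_measurable.
Qed.

Lemma closure_supported (C : set 'cV[R]_n) (A : 'M[R]_(k, n)) u :
  supported C A u -> supported (closure C) A u.
Proof.
move=> uC c Cc.
have clD : closed [set x : 'cV[R]_n | 0 <= (u *m A *m x) ord0 ord0].
  apply: closed_ge0; apply: entrywise_continuousM; first exact: entrywise_continuous_cst.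
  by move=> i j; exact: coord_continuous.
have : closure [set x : 'cV[R]_n | 0 <= (u *m A *m x) ord0 ord0] c by exact: closure_subset uC _ Cc.
by rewrite -(closure_id _).1.
Qed.

Lemma closure_scale (C : set 'cV[R]_n) (a : R) x : convex_cone C -> 0 <= a ->
  closure C x -> closure C (a *: x).
Proof.
move=> [_ _ CZ] a0 Cx.
have clD : closed [set y : 'cV[R]_n | closure C (a *: y)].
  apply: (@preimage_closed _ _ (fun y : 'cV[R]_n => a *: y) (closure C)).
    by move=> y _; exact: scaler_continuous.
  exact: closed_closure.
have : closure [set y : 'cV[R]_n | closure C (a *: y)] x.
  by move: Cx; apply: closure_subset => y Cy /=; apply: subset_closure; exact: CZ.
by rewrite -(closure_id _).1.
Qed.

Lemma grassmann_angle_gaussian (G : probability BM R) (C : set 'cV[R]_n) :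
  gaussian_law G -> convex_cone C -> ~ is_linear_subspace C ->
  grassmann_angle k C = G [set A | [set A *m x | x in C] = setT].
Proof.
move=> GG cC nC; rewrite /grassmann_angle; case: ifPn => [kn|nk]; last first.
  rewrite (_ : mkset _ = set0) ?measure0//; apply/seteqP; split=> // A /= /mulmx_surj_row_free.
  rewrite /row_free => /eqP rA; move: nk; rewrite -ltnNge ltnNge -{1}rA => /negP; apply.
  exact: rank_leq_col.
have mE : measurable ([set A | [set A *m x | x in C] = setT] : set BM).
  by apply: measurable_open; exact: open_mulmx_cone_setT.
have mpre S : measurable S ->
    measurable ((fun A : BM => kernel_projection A : borel 'M[R]_n) @^-1` S).
  by move=> mS; rewrite -[X in measurable X]setTI; exact: measurable_kernel_projection.
apply/eqP; rewrite eq_le; apply/andP; split; last first.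
  (* Lower bound: whenever [A C] is everything, the kernel of [A] meets [C] outside 0, so its
     projection lies in [B]. *)
  apply: mu_ext_le => B mB SB; rewrite [leRHS](haar_grassmannianE GG kn mB).
  apply: le_measure; rewrite ?inE//; first exact: mpre.
  move=> A /= AC; apply: SB => /= CW.
  have uA : A *m A^T \in unitmx by rewrite -unitmx_mulmx_tr; exact: mulmx_surj_row_free AC.
  have [x Cx nCx] := not_subspace_witness cC nC; have [_ CD _] := cC.
  have [y Cy Ay] : [set A *m x | x in C] (A *m - x) by rewrite AC.
  have : (C `&` subspace_of (kernel_projection A)) (y + x).
    split; first exact: CD.
    by apply/(kernel_projectionP uA); rewrite mulmxDr Ay mulmxN addNr.
  rewrite CW => /= yx; apply: nCx; rewrite (_ : - x = y)//.
  by apply/esym/eqP; rewrite -addr_eq0 yx.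
pose CC := closure C.
have CCZ a x : 0 < a -> CC x -> CC (a *: x) by move=> /ltW; exact: closure_scale.
have clCC : closed CC by exact: closed_closure.
(* Upper bound: the range of [W] is the kernel of [1 - W], so meeting the closed cone becomes a
   Borel condition on [W]. *)
pose H : set (borel 'M[R]_n) := (fun W => 1%:M - W) @^-1` meets_kernel CC.
have mH : measurable H.
  have mf : measurable_fun setT (fun W : borel 'M[R]_n => 1%:M - W : borel 'M[R]_n).
    apply: measurable_mx => i j; under eq_fun do rewrite !mxE.
    by apply: measurable_funB => //; exact: measurable_entry.
  by rewrite -[X in measurable X]setTI; apply: mf => //; exact: measurable_meets_kernel.
have SH : [set W | C `&` subspace_of W <> [set 0]] `<=` H.
  move=> W /= CW; apply: contrapT => nH; apply: CW; apply/seteqP; split=> [x [Cx Wx]|_ ->].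
    apply: contrapT => /eqP x0; apply: nH; exists x => //; split; first exact: subset_closure.
    by rewrite mulmxBl mul1mx Wx subrr.
  by split; [by case: cC|rewrite /subspace_of/= mulmx0].
apply: (le_trans (le_mu_ext (haar_grassmannian R n (n - k)%N) SH)).
rewrite measurable_mu_extE// [leLHS](haar_grassmannianE GG kn mH).
have [N1 mN1 [GN1 hN1]] := gaussian_law_row_free GG kn.
have [N2 mN2 [GN2 hN2]] := touching_null GG CCZ clCC.
set E := [set A | _] in mE *.
(* Outside [N1] the rank is full; if [A C] is not everything, a separating functional makes [A]
   touch the closed cone, so [A] lies in [N2]. *)
apply: (@le_trans _ _ (G (E `|` (N1 `|` N2)))).
  apply: le_measure; rewrite ?inE; [exact: mpre|by do 2 apply: measurableU => //|].
  move=> A [x x0 [Cx kx]].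
  have [fA|nfA] := boolP (row_free A); last by right; left; exact: hN1.
  have [AE|nAE] := pselect (E A); [by left|right; right; apply: hN2; split].
    have cAC : convex_cone [set A *m x | x in C].
      have [C0 CD CZ] := cC; split; first by exists 0; rewrite ?mulmx0.
        by move=> _ _ [y Cy <-] [z Cz <-]; exists (y + z); rewrite ?mulmxDr//; exact: CD.
      by move=> a _ a0 [y Cy <-]; exists (a *: y); rewrite ?scalemxAr//; exact: CZ.
    have [u u0 uAC] := cone_separation cAC nAE.
    exists u => //; apply: closure_supported => c Cc.
    by rewrite -mulmxA; apply: uAC; exists c.
  exists x => //; split=> //; rewrite unitmx_mulmx_tr in fA.
  apply/(kernel_projectionP fA); move: kx; rewrite mulmxBl mul1mx => /subr0_eq.
  by [].
have mN : measurable (N1 `|` N2) by exact: measurableU.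
apply: (le_trans (measureU2 G mE mN)).
rewrite -[leRHS]adde0; apply: leeD => //.
apply: (le_trans (measureU2 G mN1 mN2)).
by rewrite [X in (X + _)%E]GN1 [X in (_ + X)%E]GN2 adde0.
Qed.

End GrassmannAngle.

Lemma random_matrix_law d (T : measurableType d) (R : realType) (P : probability T R)
    (k n : nat) (X : 'I_k -> 'I_n -> {RV P >-> R}) : standard_gaussian_entries X ->
  exists2 G : probability (borel 'M[R]_(k, n)) R, gaussian_law G &
    forall S, G S = P (random_matrix X @^-1` S).
Proof.
move=> [Xlaw Xind].
have mA : measurable_fun setT (random_matrix X : T -> borel 'M[R]_(k, n)).
  by apply: measurable_mx => i j; under eq_fun do rewrite mxE; exact: measurable_funPT.
have [G GE] := image_probability P mA; exists G => // B mB.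
rewrite GE; have := Xind [set: 'I_k * 'I_n]%SET (fun ij => B ij.1 ij.2) (fun ij => mB ij.1 ij.2).
rewrite (_ : \bigcap_(_ in _) _ = random_matrix X @^-1` rect B); last first.
  apply/seteqP; split=> w /= h; last by move=> [i j] _; have := h i j; rewrite mxE.
  by move=> i j; rewrite mxE; apply: (h (i, j)); rewrite /= inE.
move=> ->; apply: eq_big => [ij|ij _]; first by rewrite inE.
by rewrite -[RHS](Xlaw ij.1 ij.2 _ (mB _ _)).
Qed.

Theorem theorem3p1 (R : realType) (n k : nat) (n_gt0 : (0 < n)%N)
    (k_gt0 : (0 < k)%N)
    (d : measure_display) (T : measurableType d) (P : probability T R)
    (X : 'I_k -> 'I_n -> {RV P >-> R}) (X_gauss : standard_gaussian_entries X)
    (M : set 'cV[R]_n) (M_borel : measurable (M : set (borel 'cV[R]_n)))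
    (M_pos : ~ is_linear_subspace (conic_hull M)) :
  let A := random_matrix X in
  grassmann_angle k (conic_hull M) =
    P [set w | conic_hull [set A w *m x | x in M] = [set: 'cV[R]_k]] /\
  P [set w | conic_hull [set A w *m x | x in M] = [set: 'cV[R]_k]] =
    P [set w | (convex_hull [set A w *m x | x in M])° 0].
Proof.
move=> A; split; last first.
  congr (P _); apply/seteqP; split=> w /=; first by move/(conic_hull_setT_interior _ k_gt0).
  by move/(conic_hull_setT_interior _ k_gt0).
have [G GG GE] := random_matrix_law X_gauss.
rewrite (grassmann_angle_gaussian GG (conic_hull_cone M) M_pos) GE.
by congr (P _); apply/funext => w; rewrite /preimage/= conic_hull_mulmx.
Qed.
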